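(* Let $\mathcal{V}=\{1,2,3,4\}$, let $k\in\mathcal{V}$ and $p\in\{0,1\}$, and let $\mathcal{W}$ be the edge weights on the complete graph on $\mathcal{V}$ given, for $i\neq j$, by $$\mathcal{W}(i,j) =\begin{cases} 0.5, & \text{if } k \in \{i,j\},\\ p, & \text{if } k \notin \{i,j\},\ j=Suc^k(i),\\ 1-p, & \text{if } k \notin \{i,j\},\ j=Pre^k(i).\end{cases}$$ Let $f:\mathbb{R}\to\mathbb{R}$ be bounded with $f>0$ and $\dot f<0$ on $(0,\pi)$. Consider on $(\mathcal{S}^2)^4$ the closed-loop system $$\dot{\Gamma}_i=\widehat{\Gamma}_i \sum_{j\in \mathcal{V}\setminus\{i\}} \mathcal{W}(i,j)\,f(\theta_{ij})\,\widehat{\Gamma}_i\Gamma_j, \qquad i\in \mathcal{V}.$$ Then the set of regular tetrahedron formations $$\Omega_T=\left\{ \mathbf{\Gamma} \in (\mathcal{S}^2)^4 : \Gamma^T_i\Gamma_j = -\tfrac{1}{3}\ \ \forall\, i \neq j \right\}$$ is an invariant manifold of this system, and it is also exponentially stable.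
   Context: $\mathcal{S}^2=\{x\in\mathbb{R}^3:\|x\|=1\}$. A point $\mathbf{\Gamma}=(\Gamma_1,\Gamma_2,\Gamma_3,\Gamma_4)\in(\mathcal{S}^2)^4$ collects the reduced attitudes of four agents. For $x=[x_1,x_2,x_3]^T\in\mathbb{R}^3$, $$\widehat{x}=\begin{pmatrix}0&-x_3&x_2\\ x_3&0&-x_1\\ -x_2&x_1&0\end{pmatrix},$$ so $\widehat{x}y=x\times y$. $\theta_{ij}=\arccos(\Gamma_i^T\Gamma_j)\in[0,\pi]$. $\dot f$ denotes the derivative of $f$. Successor and predecessor skipping $k$: node labels are read cyclically modulo $4$ with representatives in $\{1,2,3,4\}$. For a node $i$, $Suc^k(i)=i+1$ if $i+1\neq k$ (modulo $4$) and $Suc^k(i)=i+2$ if $i+1=k$ (modulo $4$). $Pre^k(i)$ is the node other than $k$ whose successor skipping $k$ is $i$. Thus $k$ has bidirectional access to all other agents and the other three agents form a directed cycle, whose direction is specified by $p$. *)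

(* Defs.v *)
From HB Require Import structures.
From mathcomp Require Import all_boot all_order all_algebra.
From mathcomp Require Import all_classical all_reals all_analysis.

Set Implicit Arguments.
Unset Strict Implicit.
Unset Printing Implicit Defensive.

Import Order.TTheory GRing.Theory Num.Theory.
Import numFieldNormedType.Exports.

Local Open Scope classical_set_scope.
Local Open Scope ring_scope.

(* Node i of {1, 2, 3, 4} is represented by i - 1 in 'I_4; the additions below
   are those of the ring 'I_4, i.e. modulo 4. *)
Definition suc_skip (k i : 'I_4) : 'I_4 :=
  if i + 1 != k then i + 1 else i + 2%:R.

(* For i != k exactly one j satisfies the condition; the default value is
   reached only when i = k, which the weights never use. *)
Definition pre_skip (k i : 'I_4) : 'I_4 :=
  odflt i [pick j | (j != k) && (suc_skip k j == i)].

Section Attitudes.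
Context {R : realType}.

(* A configuration is the 3 x 4 matrix whose i-th column is Gamma_i. *)
Definition config := 'M[R]_(3, 4).

Definition agent (G : config) (i : 'I_4) : 'cV[R]_3 := col i G.

Definition dot (x y : 'cV[R]_3) : R := \sum_(a < 3) x a 0 * y a 0.

(* The canonical topology of 'M[R]_(m, n) comes from the sup norm, whereas the
   sphere and the distance to a set use the Euclidean norm. *)
Definition enorm m n (A : 'M[R]_(m, n)) : R :=
  Num.sqrt (\sum_(a < m) \sum_(b < n) A a b ^+ 2).

Definition edist_set m n (A : 'M[R]_(m, n)) (M : set 'M[R]_(m, n)) : R :=
  inf [set enorm (A - B) | B in M].

Definition S2_4 : set config := [set G | forall i, enorm (agent G i) = 1].

Definition hat (x : 'cV[R]_3) : 'M[R]_3 :=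
  let x1 := x 0 0 in let x2 := x 1 0 in let x3 := x 2%:R 0 in
  \matrix_(a, b) nth 0 (nth [::]
    [:: [::   0; - x3;   x2];
        [::  x3;    0; - x1];
        [:: - x2;  x1;    0]] a) b.

Definition theta (G : config) (i j : 'I_4) : R :=
  acos (dot (agent G i) (agent G j)).

(* Only used for i != j; the last case is then unreachable. *)
Definition weight (k : 'I_4) (p : R) (i j : 'I_4) : R :=
  if (k == i) || (k == j) then 2%:R^-1
  else if j == suc_skip k i then p
  else if j == pre_skip k i then 1 - p
  else 0.

Definition closed_loop (k : 'I_4) (p : R) (f : R -> R) (G : config)
    (i : 'I_4) : 'cV[R]_3 :=
  hat (agent G i) *m
    \sum_(j | j != i)
      (weight k p i j * f (theta G i j)) *: (hat (agent G i) *m agent G j).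

(* Solutions on an arbitrary interval: at an endpoint belonging to I only
   continuity is required. *)
Definition is_solution (X : config -> 'I_4 -> 'cV[R]_3) (I : interval R)
    (G : R -> config) : Prop :=
  [/\ {within [set` I], continuous G},
      forall t, t \in I -> S2_4 (G t) &
      forall t i, [set` I]° t ->
        is_derive t (1 : R) (fun s => agent (G s) i) (X (G t) i)].

Definition tetrahedra : set config :=
  [set G | S2_4 G /\
     forall i j, i != j -> dot (agent G i) (agent G j) = - 3%:R^-1].

(* Invariance in both time directions, for every (possibly only local)
   solution. *)
Definition invariant_set (X : config -> 'I_4 -> 'cV[R]_3) (M : set config) :
    Prop :=
  forall (I : interval R) (G : R -> config), is_solution X I G ->
    0 \in I -> M (G 0) -> forall t, t \in I -> M (G t).

Definition exponentially_stable (X : config -> 'I_4 -> 'cV[R]_3)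
    (M : set config) : Prop :=
  exists delta c lambda : R, [/\ 0 < delta, 0 < c, 0 < lambda &
    forall (I : interval R) (G : R -> config), is_solution X I G ->
      0 \in I -> edist_set (G 0) M < delta ->
      forall t, t \in I -> 0 <= t ->
        edist_set (G t) M <= c * expR (- (lambda * t)) * edist_set (G 0) M].

End Attitudes.

Section Submanifolds.
Context {R : realType} {V : normedModType R}.

Fixpoint Ck_on (n : nat) (U : set V) (g : V -> R) : Prop :=
  if n is n'.+1 then
    (forall x, U x -> differentiable g x) /\
    (forall v : V, Ck_on n' U (fun x => 'D_v g x))
  else forall x, U x -> {for x, continuous g}.

Definition smooth_on (U : set V) (g : V -> R) : Prop :=
  forall n, Ck_on n U g.

(* Embedded smooth submanifold of codimension c: locally the zero set of c
   smooth functions whose differentials are linearly independent along it. *)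
Definition submanifold (c : nat) (M : set V) : Prop :=
  forall x, M x -> exists (U : set V) (F : 'I_c -> V -> R),
    [/\ open U, U x,
        forall i, smooth_on U (F i),
        forall y, U y -> (M y <-> forall i, F i y = 0) &
        forall y, U y -> M y -> forall a : 'I_c -> R,
          (forall v : V, \sum_i a i * 'D_v (F i) y = 0) -> forall i, a i = 0].

End Submanifolds.

Arguments config R : clear implicits.

(* An embedded submanifold of the space of 3 x 4 matrices contained in S2_4
   is the same thing as an embedded submanifold of S2_4. *)
Definition invariant_manifold {R : realType}
    (X : config R -> 'I_4 -> 'cV[R]_3) (M : set (config R)) : Prop :=
  [/\ M `<=` S2_4, exists c : nat, submanifold c M & invariant_set X M].

(* Main.v *)
Require Import Defs.
From mathcomp Require Import all_boot all_order all_algebra.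
From mathcomp Require Import all_classical all_reals all_analysis.
From mathcomp Require Import ring lra.
Import Order.TTheory GRing.Theory Num.Theory.
Import numFieldNormedType.Exports.
Local Open Scope classical_set_scope.
Local Open Scope ring_scope.

(** The equations depend only on the cosines c(i, j) of the angles between the
agents, so the proof studies the six gaps e(i, j) = c(i, j) + 1/3, which vanish
together exactly on the tetrahedra.  Name the agents so that the hub k comes
first and each of the rim agents 1, 2, 3 is repelled by the hub and by its
successor in the cycle 1 -> 2 -> 3 -> 1; both values of p reduce to this
([weight_hub]).  With g = f o acos, gamma = g(-1/3) > 0 and
beta = g'(-1/3) > 0, the gaps obey e' = beta A e + gamma B e + o(|e|) for two
constant 6 x 6 matrices A and B ([spoke_expansion], [rim_expansion]).

Because of the directed cycle this is not a gradient flow, but one quadratic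
form V works whatever the ratio of beta and gamma is: pairing the edge from the
hub to rim agent i with the rim edge from i to its successor, V is the sum of
u^2 + w^2 - u w over the three pairs.  Along B it decreases at a definite rate
([lyap_lin_gamma]); along A it does so up to the square of the sum of all gaps
([lyap_lin_beta]).  That sum is of second order: it is half the squared length
of the sum of the four unit vectors, and that vector sum is as small as the
distance to the nearest tetrahedron, where it is zero ([gap_sum_le]).  So near
the tetrahedra V' <= - lambda V and |V'| <= L V ([lyap_decay]).

A comparison argument that also keeps V below the threshold for all later times
([gronwall]) turns the first inequality into exponential decay of V; the second
one, used in both directions of time, propagates V = 0, which is invariance.
Invariance needs this argument because f is only assumed differentiable, so
uniqueness of solutions is not available in general, but the bound on V'
suffices at the zeros of V.

The gaps and the distance to the set of tetrahedra bound each other linearly.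
One bound is the Lipschitz continuity of inner products; for the other, a
tetrahedron close to a given configuration is built by correcting the second
and third vectors one after the other, the fourth being minus the sum of the
first three ([near_tetrahedra]).  Finally the tetrahedra form a submanifold of
codimension nine, cut out by the vanishing of the vector sum (three equations)
and the six inner products of the first three vectors
([tetrahedra_submanifold]). *)

(** * Rates of change of the cosines and the Lyapunov form *)

Section Shape.
Context {R : realFieldType}.
Implicit Types a b u w m eta beta gamma : R.

(** Rate of the cosine between the hub and rim agent 1.  Here a1, a2, a3 are the
cosines between the hub and the rim agents, and b1, b2, b3 those of the rim pairs
(1, 2), (2, 3), (3, 1); shifting both triples cyclically gives the other two
spokes. *)
Definition spoke_rate (g : R -> R) a1 a2 a3 b1 b2 b3 : R :=
  - (g a1 * (1 - a1 * a1)) - 2^-1 * (g a2 * (b1 - a2 * a1))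
  - 2^-1 * (g a3 * (b3 - a3 * a1)) - g b1 * (a2 - b1 * a1).

(** Rate of the cosine of the rim pair (1, 2), with the same conventions. *)
Definition rim_rate (g : R -> R) a1 a2 a3 b1 b2 b3 : R :=
  - (2^-1 * (g a1 * (a2 - a1 * b1))) - g b1 * (1 - b1 * b1)
  - 2^-1 * (g a2 * (a1 - a2 * b1)) - g b2 * (b3 - b2 * b1).

(** Linearisations of the two rates at the tetrahedron, where u and w are the
gaps of the spokes and of the rim edges; the constant terms cancel, which says
that the shape of a tetrahedron is stationary. *)
Definition spoke_lin beta gamma u1 u2 u3 w1 w2 w3 : R :=
  beta * (- (8 / 9) * u1 + 2 / 9 * u2 + 2 / 9 * u3 + 4 / 9 * w1)
  - gamma * (4 / 3 * u1 + 7 / 6 * u2 + 6^-1 * u3 + 5 / 6 * w1 + 2^-1 * w3).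

Definition rim_lin beta gamma u1 u2 u3 w1 w2 w3 : R :=
  beta * (- (8 / 9) * w1 + 2 / 9 * u1 + 2 / 9 * u2 + 4 / 9 * w2)
  - gamma * (4 / 3 * w1 + 2 / 3 * u1 + 2 / 3 * u2 + 3^-1 * w2 + w3).

(** Every summand of a rate has the form g(x) (y - x z) with x, z near -1/3 and
y near y0, where y0 is 1 or -1/3.  The error has two sources: the Taylor
remainder of g, which is small relative to m, and products of two gaps, which
are at most m ^ 2 <= eta m. *)
Lemma term_expansion beta gamma eta m gx e1 e2 e3 y0 :
  0 <= beta -> 0 <= gamma -> m <= eta -> m <= 1 ->
  0 <= y0 - 9^-1 <= 1 \/ -1 <= y0 - 9^-1 <= 0 ->
  `|gx - gamma - beta * e1| <= eta * m ->
  `|e1| <= m -> `|e2| <= m -> `|e3| <= m ->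
  `|gx * (y0 + e2 - (e1 - 3^-1) * (e3 - 3^-1))
    - (gamma * (y0 - 9^-1) + beta * e1 * (y0 - 9^-1)
       + gamma * (e2 + (e1 + e3) / 3))| <= (5 + 4 * beta + gamma) * (eta * m).
Proof.
move=> b0 c0 me m1 hy hr h1 h2 h3.
have m0 : 0 <= m by exact: le_trans h1.
pose q := y0 + e2 - (e1 - 3^-1) * (e3 - 3^-1).
have h13 : `|e1 * e3| <= m * m by rewrite normrM ler_pM.
have mm : m * m <= eta * m by rewrite ler_wpM2r.
have mm1 : m * m <= m by rewrite ler_piMl.
have hq0 : `|q - (y0 - 9^-1)| <= 3 * m.
  have -> : q - (y0 - 9^-1) = e2 + (e1 + e3) / 3 - e1 * e3 by rewrite /q; field.
  move: h1 h2 h3 h13; rewrite !ler_norml; lra.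
have hq : `|q| <= 5.
  by move: hq0; rewrite !ler_norml; lra.
have -> : gx * q - (gamma * (y0 - 9^-1) + beta * e1 * (y0 - 9^-1)
       + gamma * (e2 + (e1 + e3) / 3)) =
   (gx - gamma - beta * e1) * q + beta * (e1 * (q - (y0 - 9^-1)))
   - gamma * (e1 * e3) by rewrite /q; field.
have A1 : `|(gx - gamma - beta * e1) * q| <= eta * m * 5.
  by rewrite normrM ler_pM.
have A2 : `|beta * (e1 * (q - (y0 - 9^-1)))| <= beta * (3 * (eta * m)).
  rewrite normrM ger0_norm // ler_wpM2l // normrM.
  apply: le_trans (ler_pM _ _ h1 hq0) _ => //; lra.
have A3 : `|gamma * (e1 * e3)| <= gamma * (eta * m).
  by rewrite normrM ger0_norm // ler_wpM2l // (le_trans h13).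
have A4 : 0 <= beta * (eta * m) by rewrite mulr_ge0 // (le_trans _ mm) // mulr_ge0.
move: A1 A2 A3; rewrite !ler_norml; lra.
Qed.

Lemma spoke_expansion g beta gamma eta m u1 u2 u3 w1 w2 w3 :
  0 <= beta -> 0 <= gamma -> m <= eta -> m <= 1 ->
  (forall e, `|e| <= m -> `|g (e - 3^-1) - gamma - beta * e| <= eta * m) ->
  `|u1| <= m -> `|u2| <= m -> `|u3| <= m -> `|w1| <= m -> `|w3| <= m ->
  `|spoke_rate g (u1 - 3^-1) (u2 - 3^-1) (u3 - 3^-1)
                 (w1 - 3^-1) (w2 - 3^-1) (w3 - 3^-1)
    - spoke_lin beta gamma u1 u2 u3 w1 w2 w3|
  <= 3 * (5 + 4 * beta + gamma) * (eta * m).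
Proof.
move=> b0 c0 me m1 hg h1 h2 h3 k1 k3.
have m0 : 0 <= m by exact: le_trans h1.
have z0 : `|0 : R| <= m by rewrite normr0.
have T y0 (hy : 0 <= y0 - 9^-1 <= 1 \/ -1 <= y0 - 9^-1 <= 0) e1 e2 e3 l1 :=
  @term_expansion _ _ _ _ _ e1 e2 e3 y0 b0 c0 me m1 hy (hg e1 l1) l1.
have y1 : 0 <= (1 : R) - 9^-1 <= 1 \/ -1 <= (1 : R) - 9^-1 <= 0 by left; lra.
have y2 : 0 <= (- 3^-1 : R) - 9^-1 <= 1 \/ -1 <= (- 3^-1 : R) - 9^-1 <= 0.
  by right; lra.
move: (T _ y1 u1 0 u1 h1 z0 h1) (T _ y2 u2 w1 u1 h2 k1 h1)
  (T _ y2 u3 w3 u1 h3 k3 h1) (T _ y2 w1 u2 u1 k1 h2 h1).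
rewrite /spoke_rate /spoke_lin !addr0 ![- 3^-1 + _]addrC !ler_norml.
by lra.
Qed.

Lemma rim_expansion g beta gamma eta m u1 u2 u3 w1 w2 w3 :
  0 <= beta -> 0 <= gamma -> m <= eta -> m <= 1 ->
  (forall e, `|e| <= m -> `|g (e - 3^-1) - gamma - beta * e| <= eta * m) ->
  `|u1| <= m -> `|u2| <= m -> `|w1| <= m -> `|w2| <= m -> `|w3| <= m ->
  `|rim_rate g (u1 - 3^-1) (u2 - 3^-1) (u3 - 3^-1)
                 (w1 - 3^-1) (w2 - 3^-1) (w3 - 3^-1)
    - rim_lin beta gamma u1 u2 u3 w1 w2 w3|
  <= 3 * (5 + 4 * beta + gamma) * (eta * m).
Proof.
move=> b0 c0 me m1 hg h1 h2 k1 k2 k3.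
have m0 : 0 <= m by exact: le_trans h1.
have z0 : `|0 : R| <= m by rewrite normr0.
have T y0 (hy : 0 <= y0 - 9^-1 <= 1 \/ -1 <= y0 - 9^-1 <= 0) e1 e2 e3 l1 :=
  @term_expansion _ _ _ _ _ e1 e2 e3 y0 b0 c0 me m1 hy (hg e1 l1) l1.
have y1 : 0 <= (1 : R) - 9^-1 <= 1 \/ -1 <= (1 : R) - 9^-1 <= 0 by left; lra.
have y2 : 0 <= (- 3^-1 : R) - 9^-1 <= 1 \/ -1 <= (- 3^-1 : R) - 9^-1 <= 0.
  by right; lra.
move: (T _ y1 w1 0 w1 k1 z0 k1) (T _ y2 u1 u2 w1 h1 h2 k1)
  (T _ y2 u2 u1 w1 h2 h1 k1) (T _ y2 w2 w3 w1 k2 k3 k1).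
rewrite /rim_rate /rim_lin !addr0 ![- 3^-1 + _]addrC !ler_norml.
by lra.
Qed.

(** The pairing of spoke i with the rim edge leaving i is what compensates the
asymmetry of the directed rim. *)
Definition lyap u1 u2 u3 w1 w2 w3 : R :=
  (u1 ^+ 2 + w1 ^+ 2 - u1 * w1) + (u2 ^+ 2 + w2 ^+ 2 - u2 * w2)
  + (u3 ^+ 2 + w3 ^+ 2 - u3 * w3).

Definition sumsq u1 u2 u3 w1 w2 w3 : R :=
  u1 ^+ 2 + u2 ^+ 2 + u3 ^+ 2 + w1 ^+ 2 + w2 ^+ 2 + w3 ^+ 2.

(** Uniform gaps are stationary for this part of the linearisation, so the form
can only decrease modulo the square of the total gap. *)
Lemma lyap_lin_beta u1 u2 u3 w1 w2 w3 :
  (2 * u1 - w1) * spoke_lin 1 0 u1 u2 u3 w1 w2 w3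
  + (2 * u2 - w2) * spoke_lin 1 0 u2 u3 u1 w2 w3 w1
  + (2 * u3 - w3) * spoke_lin 1 0 u3 u1 u2 w3 w1 w2
  + (2 * w1 - u1) * rim_lin 1 0 u1 u2 u3 w1 w2 w3
  + (2 * w2 - u2) * rim_lin 1 0 u2 u3 u1 w2 w3 w1
  + (2 * w3 - u3) * rim_lin 1 0 u3 u1 u2 w3 w1 w2
  <= - 3^-1 * sumsq u1 u2 u3 w1 w2 w3 + (u1 + u2 + u3 + w1 + w2 + w3) ^+ 2.
Proof.
rewrite /spoke_lin /rim_lin /sumsq.
have := sqr_ge0 (u1 + u2 + u3 + w1 + w2 + w3).
have := sqr_ge0 (u1 + u2 + u3).
have := sqr_ge0 (w1 + w2 + w3).
have := (sqr_ge0 (u1 - w1 - (u2 - w2)), sqr_ge0 (u1 - w1 - (u3 - w3)),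
         sqr_ge0 (u2 - w2 - (u3 - w3))).
have := (sqr_ge0 (u1 + w2), sqr_ge0 (u2 + w3), sqr_ge0 (u3 + w1)).
have := (sqr_ge0 (u1 - w3), sqr_ge0 (u2 - w1), sqr_ge0 (u3 - w2)).
have := (sqr_ge0 w1, sqr_ge0 w2, sqr_ge0 w3).
move=> [[? ?] ?] [[? ?] ?] [[? ?] ?] [[? ?] ?] ? ? ?.
lra.
Qed.

(** The mixed terms u w are absorbed by squares of u + w or u - w; what is left
of the diagonal dominates the quarter of the squared norm. *)
Lemma lyap_lin_gamma u1 u2 u3 w1 w2 w3 :
  (2 * u1 - w1) * spoke_lin 0 1 u1 u2 u3 w1 w2 w3
  + (2 * u2 - w2) * spoke_lin 0 1 u2 u3 u1 w2 w3 w1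
  + (2 * u3 - w3) * spoke_lin 0 1 u3 u1 u2 w3 w1 w2
  + (2 * w1 - u1) * rim_lin 0 1 u1 u2 u3 w1 w2 w3
  + (2 * w2 - u2) * rim_lin 0 1 u2 u3 u1 w2 w3 w1
  + (2 * w3 - u3) * rim_lin 0 1 u3 u1 u2 w3 w1 w2
  <= - 4^-1 * sumsq u1 u2 u3 w1 w2 w3.
Proof.
rewrite /spoke_lin /rim_lin /sumsq.
have := sqr_ge0 (u1 + u2 + u3).
have := sqr_ge0 (w1 + w2 + w3).
have := (sqr_ge0 (u1 + w1), sqr_ge0 (u2 + w2), sqr_ge0 (u3 + w3)).
have := (sqr_ge0 (u1 - w2), sqr_ge0 (u2 - w3), sqr_ge0 (u3 - w1)).
have := (sqr_ge0 (u1 + w3), sqr_ge0 (u2 + w1), sqr_ge0 (u3 + w2)).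
have := (sqr_ge0 u1, sqr_ge0 u2, sqr_ge0 u3).
have := (sqr_ge0 w1, sqr_ge0 w2, sqr_ge0 w3).
move=> [[? ?] ?] [[? ?] ?] [[? ?] ?] [[? ?] ?] [[? ?] ?] ? ?.
lra.
Qed.
End Shape.

Section Decay.
Context {R : rcfType}.

(** Derivative of the Lyapunov form along the vector field whose components are
the cyclic shifts of s (spokes) and r (rim edges). *)
Definition along_lyap (s r : R -> R -> R -> R -> R -> R -> R)
    (u1 u2 u3 w1 w2 w3 : R) : R :=
  (2 * u1 - w1) * s u1 u2 u3 w1 w2 w3
  + (2 * u2 - w2) * s u2 u3 u1 w2 w3 w1
  + (2 * u3 - w3) * s u3 u1 u2 w3 w1 w2
  + (2 * w1 - u1) * r u1 u2 u3 w1 w2 w3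
  + (2 * w2 - u2) * r u2 u3 u1 w2 w3 w1
  + (2 * w3 - u3) * r u3 u1 u2 w3 w1 w2.

Definition shifted (h : R -> R -> R -> R -> R -> R -> R) (u1 u2 u3 w1 w2 w3 : R) : R :=
  h (u1 - 3^-1) (u2 - 3^-1) (u3 - 3^-1) (w1 - 3^-1) (w2 - 3^-1) (w3 - 3^-1).

Definition lyap_rate (g : R -> R) : R -> R -> R -> R -> R -> R -> R :=
  along_lyap (shifted (spoke_rate g)) (shifted (rim_rate g)).

Lemma along_lyap_le (s r s' r' : R -> R -> R -> R -> R -> R -> R) m k
    u1 u2 u3 w1 w2 w3 :
  `|u1| <= m -> `|u2| <= m -> `|u3| <= m ->
  `|w1| <= m -> `|w2| <= m -> `|w3| <= m ->
  (forall x1 x2 x3 y1 y2 y3,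
     `|x1| <= m -> `|x2| <= m -> `|x3| <= m ->
     `|y1| <= m -> `|y2| <= m -> `|y3| <= m ->
     `|s x1 x2 x3 y1 y2 y3 - s' x1 x2 x3 y1 y2 y3| <= k /\
     `|r x1 x2 x3 y1 y2 y3 - r' x1 x2 x3 y1 y2 y3| <= k) ->
  `|along_lyap s r u1 u2 u3 w1 w2 w3 - along_lyap s' r' u1 u2 u3 w1 w2 w3|
    <= 18 * (m * k).
Proof.
move=> h1 h2 h3 k1 k2 k3 hk.
have [d1 e1] := hk _ _ _ _ _ _ h1 h2 h3 k1 k2 k3.
have [d2 e2] := hk _ _ _ _ _ _ h2 h3 h1 k2 k3 k1.
have [d3 e3] := hk _ _ _ _ _ _ h3 h1 h2 k3 k1 k2.
have P x y z : `|x| <= m -> `|y| <= m -> `|z| <= k ->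
    `|(2 * x - y) * z| <= 3 * (m * k).
  move=> hx hy hz; rewrite mulrA normrM ler_pM //.
  by move: hx hy; rewrite !ler_norml; lra.
move: (P _ _ _ h1 k1 d1) (P _ _ _ h2 k2 d2) (P _ _ _ h3 k3 d3)
  (P _ _ _ k1 h1 e1) (P _ _ _ k2 h2 e2) (P _ _ _ k3 h3 e3).
rewrite /along_lyap !ler_norml; lra.
Qed.

Lemma lin_rate_le (beta gamma m : R) u1 u2 u3 w1 w2 w3 :
  0 <= beta -> 0 <= gamma ->
  `|u1| <= m -> `|u2| <= m -> `|u3| <= m ->
  `|w1| <= m -> `|w2| <= m -> `|w3| <= m ->
  `|spoke_lin beta gamma u1 u2 u3 w1 w2 w3| <= (2 * beta + 4 * gamma) * m /\
  `|rim_lin beta gamma u1 u2 u3 w1 w2 w3| <= (2 * beta + 4 * gamma) * m.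
Proof.
move=> b0 c0; rewrite !ler_norml => h1 h2 h3 k1 k2 k3.
have P b A (B : R) : 0 <= b -> -B <= A <= B -> - (b * B) <= b * A <= b * B.
  by move=> hb /andP[? ?]; rewrite -mulrN !ler_wpM2l.
have A1 : - (2 * m) <= - (8 / 9) * u1 + 2 / 9 * u2 + 2 / 9 * u3 + 4 / 9 * w1 <= 2 * m by lra.
have A2 : - (4 * m) <= 4 / 3 * u1 + 7 / 6 * u2 + 6^-1 * u3 + 5 / 6 * w1 + 2^-1 * w3 <= 4 * m by lra.
have A3 : - (2 * m) <= - (8 / 9) * w1 + 2 / 9 * u1 + 2 / 9 * u2 + 4 / 9 * w2 <= 2 * m by lra.
have A4 : - (4 * m) <= 4 / 3 * w1 + 2 / 3 * u1 + 2 / 3 * u2 + 3^-1 * w2 + w3 <= 4 * m by lra.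
move: (P beta _ _ b0 A1) (P gamma _ _ c0 A2) (P beta _ _ b0 A3) (P gamma _ _ c0 A4).
rewrite /spoke_lin /rim_lin; lra.
Qed.

Lemma sumsq_entries (N : R) u1 u2 u3 w1 w2 w3 : sumsq u1 u2 u3 w1 w2 w3 <= N ->
  [/\ `|u1| <= Num.sqrt N, `|u2| <= Num.sqrt N & `|u3| <= Num.sqrt N] /\
  [/\ `|w1| <= Num.sqrt N, `|w2| <= Num.sqrt N & `|w3| <= Num.sqrt N].
Proof.
rewrite /sumsq => hN.
have := (sqr_ge0 u1, sqr_ge0 u2, sqr_ge0 u3).
have := (sqr_ge0 w1, sqr_ge0 w2, sqr_ge0 w3).
move=> [[? ?] ?] [[? ?] ?].
by split; split; rewrite -sqrtr_sqr ler_wsqrtr //; lra.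
Qed.

Lemma lyap_bounds (u1 u2 u3 w1 w2 w3 : R) :
  sumsq u1 u2 u3 w1 w2 w3 <= 2 * lyap u1 u2 u3 w1 w2 w3 /\
  2 * lyap u1 u2 u3 w1 w2 w3 <= 3 * sumsq u1 u2 u3 w1 w2 w3.
Proof.
have := (sqr_ge0 (u1 - w1), sqr_ge0 (u2 - w2), sqr_ge0 (u3 - w3)).
have := (sqr_ge0 (u1 + w1), sqr_ge0 (u2 + w2), sqr_ge0 (u3 + w3)).
by move=> [[? ?] ?] [[? ?] ?]; rewrite /lyap /sumsq; split; lra.
Qed.

(** The bound on the total gap makes the positive term beta (total gap) ^ 2 of
[lyap_lin_beta] quartic in the gaps; it and the Taylor remainder then cost at
most half of the decay rate kappa. *)
Lemma lyap_decay (g : R -> R) (beta gamma C : R) :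
  0 < beta -> 0 < gamma -> 0 <= C ->
  (forall eta, 0 < eta -> exists2 d, 0 < d &
     forall e, `|e| <= d -> `|g (e - 3^-1) - gamma - beta * e| <= eta * `|e|) ->
  exists r lambda L, [/\ 0 < r, 0 < lambda, 0 < L &
    forall u1 u2 u3 w1 w2 w3, sumsq u1 u2 u3 w1 w2 w3 <= r ->
      `|u1 + u2 + u3 + w1 + w2 + w3| <= C * sumsq u1 u2 u3 w1 w2 w3 ->
      lyap_rate g u1 u2 u3 w1 w2 w3 <= - lambda * lyap u1 u2 u3 w1 w2 w3 /\
      `|lyap_rate g u1 u2 u3 w1 w2 w3| <= L * lyap u1 u2 u3 w1 w2 w3].
Proof.
move=> b0 c0 C0 hg.
pose K := 3 * (5 + 4 * beta + gamma); pose kappa := beta / 3 + gamma / 4.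
pose D := 18 * K + beta * C ^+ 2.
have K0 : 0 < K by rewrite /K; lra.
have kap0 : 0 < kappa by rewrite /kappa; lra.
have bC : 0 <= beta * C ^+ 2 by rewrite mulr_ge0 ?sqr_ge0 // ltW.
have D0 : 0 < D by rewrite /D; lra.
pose eta := Num.min 1 (kappa / 2 / D).
have eta0 : 0 < eta by rewrite lt_min ltr01 !divr_gt0.
have eta1 : eta <= 1 by rewrite ge_min lexx.
have etaD : D * eta <= kappa / 2.
  rewrite mulrC -ler_pdivlMr //; by rewrite ge_min lexx orbT.
have [d d0 hd] := hg _ eta0.
pose q := Num.min d eta.
have q0 : 0 < q by rewrite lt_min d0.
exists (q ^+ 2), (kappa / 3), (36 * (2 * beta + 4 * gamma + K)).
split; rewrite ?exprn_gt0 ?divr_gt0 ?mulr_gt0 //; first by lra.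
move=> u1 u2 u3 w1 w2 w3 hN hS.
set N := sumsq _ _ _ _ _ _ in hN hS.
have N0 : 0 <= N.
  by rewrite /N /sumsq !addr_ge0 ?sqr_ge0.
pose m := Num.sqrt N.
have mm : m * m = N by rewrite -expr2 sqr_sqrtr.
have m0 : 0 <= m by exact: sqrtr_ge0.
have mq : m <= q by rewrite -[q]ger0_norm ?(ltW q0) // -sqrtr_sqr ler_wsqrtr.
have md : m <= d by rewrite (le_trans mq) // ge_min lexx.
have me : m <= eta by rewrite (le_trans mq) // ge_min lexx orbT.
have m1 : m <= 1 by rewrite (le_trans me).
have [[h1 h2 h3] [k1 k2 k3]] := @sumsq_entries N _ _ _ _ _ _ (lexx N).
rewrite -/m in h1 h2 h3 k1 k2 k3.
have hg' e : `|e| <= m -> `|g (e - 3^-1) - gamma - beta * e| <= eta * m.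
  move=> he; apply: le_trans (hd _ (le_trans he md)) _.
  by rewrite ler_wpM2l // ltW.
have E : `|lyap_rate g u1 u2 u3 w1 w2 w3 -
    along_lyap (spoke_lin beta gamma) (rim_lin beta gamma) u1 u2 u3 w1 w2 w3|
    <= 18 * (m * (K * (eta * m))).
  apply: along_lyap_le => // *; split.
    by apply: spoke_expansion => //; exact: ltW.
  by apply: rim_expansion => //; exact: ltW.
have F : `|along_lyap (spoke_lin beta gamma) (rim_lin beta gamma) u1 u2 u3 w1 w2 w3|
    <= 18 * (m * ((2 * beta + 4 * gamma) * m)).
  have := @along_lyap_le (spoke_lin beta gamma) (rim_lin beta gamma)
    (fun _ _ _ _ _ _ => 0) (fun _ _ _ _ _ _ => 0) m ((2 * beta + 4 * gamma) * m)
     u1 u2 u3 w1 w2 w3 h1 h2 h3 k1 k2 k3.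
  rewrite {2}/along_lyap !mulr0 !addr0 subr0; apply.
  by move=> *; rewrite !subr0; apply: lin_rate_le => //; exact: ltW.
have {}E : `|lyap_rate g u1 u2 u3 w1 w2 w3 -
    along_lyap (spoke_lin beta gamma) (rim_lin beta gamma) u1 u2 u3 w1 w2 w3|
    <= 18 * K * eta * N.
  by apply: le_trans E _; rewrite -mm le_eqVlt; apply/orP; left; apply/eqP; ring.
have {}F : `|along_lyap (spoke_lin beta gamma) (rim_lin beta gamma) u1 u2 u3 w1 w2 w3|
    <= 18 * (2 * beta + 4 * gamma) * N.
  by apply: le_trans F _; rewrite -mm le_eqVlt; apply/orP; left; apply/eqP; ring.
have G : along_lyap (spoke_lin beta gamma) (rim_lin beta gamma) u1 u2 u3 w1 w2 w3
   <= - kappa * N + beta * (u1 + u2 + u3 + w1 + w2 + w3) ^+ 2.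
  have -> : along_lyap (spoke_lin beta gamma) (rim_lin beta gamma) u1 u2 u3 w1 w2 w3
    = beta * along_lyap (spoke_lin 1 0) (rim_lin 1 0) u1 u2 u3 w1 w2 w3
      + gamma * along_lyap (spoke_lin 0 1) (rim_lin 0 1) u1 u2 u3 w1 w2 w3.
    by rewrite /along_lyap /spoke_lin /rim_lin; field.
  have := ler_wpM2l (ltW b0) (lyap_lin_beta u1 u2 u3 w1 w2 w3).
  have := ler_wpM2l (ltW c0) (lyap_lin_gamma u1 u2 u3 w1 w2 w3).
  rewrite -/(along_lyap (spoke_lin 1 0) (rim_lin 1 0) u1 u2 u3 w1 w2 w3)
    -/(along_lyap (spoke_lin 0 1) (rim_lin 0 1) u1 u2 u3 w1 w2 w3) -/N /kappa.
  lra.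
have S2 : beta * (u1 + u2 + u3 + w1 + w2 + w3) ^+ 2 <= beta * C ^+ 2 * eta * N.
  have -> : beta * C ^+ 2 * eta * N = beta * (C ^+ 2 * (eta * N)) by ring.
  apply: ler_wpM2l; first exact: ltW.
  rewrite -real_normK ?num_real //.
  apply: (@le_trans _ _ ((C * N) ^+ 2)).
    by rewrite ler_sqr ?nnegrE // mulr_ge0.
  rewrite exprMn; apply: ler_wpM2l; first exact: sqr_ge0.
  rewrite expr2; apply: ler_wpM2r => //; rewrite -mm.
  by apply: le_trans me; rewrite ler_piMl.
have [V1 V2] := lyap_bounds u1 u2 u3 w1 w2 w3.
rewrite -/N in V1 V2.
have T : 18 * K * eta * N + beta * C ^+ 2 * eta * N <= kappa / 2 * N.
  by rewrite -!mulrDl ler_wpM2r.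
have eN : 18 * K * eta * N <= 18 * K * N.
  by rewrite ler_wpM2r // ler_piMr // mulr_ge0 // ltW.
split.
  have kV : kappa * (2 * lyap u1 u2 u3 w1 w2 w3) <= kappa * (3 * N).
    by rewrite ler_wpM2l // ltW.
  move: E; rewrite ler_norml => /andP[_ E]; lra.
have Z : 0 <= 2 * beta + 4 * gamma + K by lra.
have LV : (2 * beta + 4 * gamma + K) * N <=
   (2 * beta + 4 * gamma + K) * (2 * lyap u1 u2 u3 w1 w2 w3).
  by rewrite ler_wpM2l.
move: E F; rewrite !ler_norml => /andP[E1 E2] /andP[F1 F2]; lra.
Qed.
End Decay.

(** * Comparison lemmas *)

Lemma gronwall_step {R : realType} (h : R -> R) (a T : R) :
  0 <= T -> {within `[0, T], continuous h} ->
  (forall t : R, 0 < t < T -> exists2 d : R, is_derive t (1 : R) h d & d <= a * h t) ->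
  h T <= h 0 * expR (a * T).
Proof.
move=> T0 hc hd.
pose k : R -> R := fun t => h t * expR (- a * t).
have kd t : t \in `]0, T[ -> exists2 d : R, is_derive t (1 : R) k d & d <= 0.
  rewrite in_itv /= => /hd[d Hd dle].
  exists (h t *: (expR (- a * t) * - a) + expR (- a * t) *: d).
    have E : is_derive t (1 : R) (fun s => expR (- a * s)) (expR (- a * t) * - a).
      have := @is_derive1_comp R expR (fun s => - a * s) t (expR (- a * t)) (- a).
      apply.
      by apply: is_derive_eq; rewrite /GRing.scale /= mulr1.
    exact: (is_deriveM Hd E).
  rewrite /GRing.scale /= mulrC -mulrA -mulrDr pmulr_rle0 ?expR_gt0 //.
  by rewrite mulNr addrC subr_le0.
have kc : {within `[0, T], continuous k}.
  apply/subspace_continuousP => x xT.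
  apply: cvgM; first by move/subspace_continuousP : hc; apply.
  apply: cvg_within_filter.
  apply: (@continuous_comp _ _ _ (fun s => - a * s) expR x); last exact: continuous_expR.
  exact: mulrl_continuous.
move: T0; rewrite le_eqVlt => /predU1P[<-|T0]; first by rewrite mulr0 expR0 mulr1.
have [||c cT E] := @MVT R k (fun t => 'D_1 k t) 0 T T0 => //.
  by move=> t /kd[d Hd _]; apply: DeriveDef => //; apply: ex_derive.
have [d Hd d0] := kd _ cT.
have : k T <= k 0.
  by rewrite -subr_le0 E (@derive_val _ _ _ _ _ _ _ Hd) subr0 pmulr_lle0.
rewrite /k mulr0 expR0 mulr1 mulNr expRN.
by rewrite ler_pdivrMr ?expR_gt0.
Qed.

(** The estimate holds up to the first time at which h reaches r, where it gives
h < r; hence there is no such time. *)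
Lemma gronwall {R : realType} (h : R -> R) (a r T : R) :
  {within `[0, T], continuous h} ->
  (forall t : R, 0 < t < T -> exists2 d : R, is_derive t (1 : R) h d &
     h t < r -> d <= a * h t) ->
  (forall t : R, 0 <= t <= T -> h 0 * expR (a * t) < r) ->
  forall t, 0 <= t <= T -> h t <= h 0 * expR (a * t).
Proof.
move=> hc hd hr.
have step t : 0 <= t <= T -> (forall s, 0 < s < t -> h s < r) ->
    h t <= h 0 * expR (a * t).
  move=> /andP[t0 tT] hs; apply: gronwall_step => //.
    apply: continuous_subspaceW hc => s /=; rewrite !in_itv /= => /andP[-> st].
    exact: le_trans tT.
  move=> s /andP[s0 st]; have [|d Hd dle] := hd s.
    by rewrite s0 (lt_le_trans st).
  by exists d => //; apply/dle/hs; rewrite s0.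
suff low t : 0 <= t <= T -> h t < r.
  move=> t /[dup] tT /andP[t0 tleT]; apply: step => // s /andP[s0 st].
  by apply: low; rewrite ltW //= (le_trans (ltW st)).
move: t => t1 t1T; rewrite ltNge; apply/negP => hrt.
pose E := [set t | 0 <= t <= T /\ r <= h t].
have Et1 : E t1 by [].
have E0 : lbound E 0 by move=> x [/andP[]].
have hE : has_inf E by split; [exists t1 | exists 0].
pose t2 := inf E.
have t2E x : E x -> t2 <= x by move=> Ex; apply: ge_inf => //; exists 0.
have t20 : 0 <= t2 by apply: lb_le_inf => //; exists t1.
have t2T : 0 <= t2 <= T.
  by rewrite t20 (le_trans (t2E _ Et1)) //; case/andP: t1T.
have h2 : h t2 < r.
  apply: le_lt_trans (hr _ t2T); apply: step => // s /andP[s0 st].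
  rewrite ltNge; apply/negP => hrs.
  have : E s by split => //; rewrite ltW //= (le_trans (ltW st)) //; case/andP: t2T.
  by move=> /t2E; rewrite leNgt st.
have /subspace_continuousP/(_ t2) := hc.
have t2T' : [set` `[0, T]] t2 by rewrite /= in_itv.
move=> /(_ t2T') /cvgrPdist_lt /(_ (r - h t2)).
rewrite subr_gt0 => /(_ h2) [e /= e0 he].
have [x Ex xe] := inf_adherent e0 hE.
have := he x; rewrite /ball_ /= distrC ger0_norm ?subr_ge0 ?t2E // ltrBlDl.
move=> /(_ xe); case: Ex => xT rx; rewrite in_itv /= => /(_ xT).
by rewrite /from_subspace ltr_norml => /andP[]; lra.
Qed.

(** The same estimate for times before 0, by reversing time. *)
Lemma gronwall_backward {R : realType} (h : R -> R) (a r T : R) :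
  {within `[T, 0], continuous h} ->
  (forall t : R, T < t < 0 -> exists2 d : R, is_derive t (1 : R) h d &
     h t < r -> - d <= a * h t) ->
  (forall t : R, T <= t <= 0 -> h 0 * expR (- (a * t)) < r) ->
  forall t : R, T <= t <= 0 -> h t <= h 0 * expR (- (a * t)).
Proof.
move=> hc hd hr t tT.
pose l := fun s => h (- s).
have := @gronwall R l a r (- T) _ _ _ (- t).
rewrite /l oppr0 opprK mulrN; apply; last 2 first.
- by move=> s sT; have := hr (- s); rewrite mulrN opprK; apply; lra.
- by lra.
- apply/subspace_continuousP => x; rewrite /= in_itv /= => xT.
  move/subspace_continuousP : hc => /(_ (- x)).
  rewrite /= in_itv /= => hx; apply/cvgrPdist_lt => e e0.
  have {}hx : T <= - x <= 0 ->
      h y @[y --> within `[T, 0]%classic (nbhs (- x))] --> h (- x) by exact: hx.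
  have xT' : T <= - x <= 0 by lra.
  have /cvgrPdist_lt /(_ _ e0) [d /= d0 hd'] := hx xT'.
  exists d => //= y; rewrite /ball_ /= => xy; rewrite in_itv /= => yT.
  by apply: hd'; rewrite /ball_ /= ?in_itv /=; [rewrite -opprD normrN | lra].
move=> s sT; have [|d Hd dle] := hd (- s); first lra.
exists (- d); last exact: dle.
have N : is_derive s (1 : R) (fun u : R => - u) (-1) by apply: is_derive_eq.
have := @is_derive1_comp R h (fun u => - u) s d (-1).
by rewrite mulrN1; apply.
Qed.

(** * Inner products and the size of vectors *)

Section Dot.
Context {R : realType}.
Implicit Types x y z : 'cV[R]_3.

Lemma dotE x y :
  dot x y = x 0 0 * y 0 0 + x 1 0 * y 1 0 + x 2%:R 0 * y 2%:R 0.
Proof.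
rewrite /dot !big_ord_recl big_ord0 addr0 addrA.
by do ![congr (_ + _)|congr (_ * _)]; congr fun_of_matrix; apply: val_inj.
Qed.

Lemma dotC x y : dot x y = dot y x.
Proof. by rewrite !dotE; ring. Qed.

Lemma dotDl x y z : dot (x + y) z = dot x z + dot y z.
Proof. by rewrite !dotE !mxE; ring. Qed.

Lemma dotZl (a : R) x y : dot (a *: x) y = a * dot x y.
Proof. by rewrite !dotE !mxE; ring. Qed.

Lemma dotNl x y : dot (- x) y = - dot x y.
Proof. by rewrite -scaleN1r dotZl mulN1r. Qed.

Lemma dotDr x y z : dot x (y + z) = dot x y + dot x z.
Proof. by rewrite dotC dotDl !(dotC x). Qed.

Lemma dotZr (a : R) x y : dot x (a *: y) = a * dot x y.
Proof. by rewrite dotC dotZl dotC. Qed.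

Lemma dotNr x y : dot x (- y) = - dot x y.
Proof. by rewrite dotC dotNl dotC. Qed.

Definition dot_lin := (dotDl, dotDr, dotZl, dotZr, dotNl, dotNr).

(** For a unit vector x the right-hand side is minus the component of y orthogonal
to x, so every agent is pushed along the sphere away from those it reacts to. *)
Lemma hat_hat x y : hat x *m (hat x *m y) = dot x y *: x - dot x x *: y.
Proof.
apply/matrixP => a b; rewrite [b]ord1 !dotE !mxE !big_ord_recl !big_ord0 /= !mxE.
rewrite !big_ord_recl !big_ord0 /= !mxE.
rewrite (_ : lift ord0 ord0 = 1 :> 'I_3); last exact: val_inj.
rewrite (_ : lift ord0 (lift ord0 ord0) = 2%:R :> 'I_3); last exact: val_inj.
rewrite (_ : ord0 = 0 :> 'I_3); last exact: val_inj.
case: a => -[|[|[|//]]] Ha /=.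
- by rewrite (_ : Ordinal Ha = 0) /=; [ring | exact: val_inj].
- by rewrite (_ : Ordinal Ha = 1) /=; [ring | exact: val_inj].
- by rewrite (_ : Ordinal Ha = 2%:R) /=; [ring | exact: val_inj].
Qed.

Lemma dot_sqr_ge0 x : 0 <= dot x x.
Proof. by rewrite sumr_ge0 // => i _; rewrite -expr2 sqr_ge0. Qed.

Lemma dot0_eq0 x : dot x x = 0 -> x = 0.
Proof.
move/eqP; rewrite psumr_eq0 => [/allP h|i _]; last by rewrite -expr2 sqr_ge0.
apply/matrixP => a b; rewrite [b]ord1 mxE.
by have := h a (mem_index_enum _); rewrite mulf_eq0 orbb => /eqP.
Qed.

Lemma entry_le1 x a : dot x x = 1 -> `|x a 0| <= 1.
Proof.
rewrite /dot (bigD1 a) //= => h.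
have s0 : 0 <= \sum_(i < 3 | i != a) x i 0 * x i 0.
  by rewrite sumr_ge0 // => i _; rewrite -expr2 sqr_ge0.
rewrite -[1](@sqrtr1 R) -sqrtr_sqr ler_wsqrtr // expr2; lra.
Qed.

Lemma dot_le x y (k l : R) :
  (forall a, `|x a 0| <= k) -> (forall a, `|y a 0| <= l) ->
  `|dot x y| <= 3 * (k * l).
Proof.
move=> hx hy; apply: le_trans (ler_norm_sum _ _ _) _.
apply: (@le_trans _ _ (\sum_(a < 3) k * l)).
  by apply: ler_sum => a _; rewrite normrM ler_pM.
by rewrite sumr_const card_ord -[X in X <= _]mulr_natl.
Qed.

Lemma enorm_unit x : enorm x = 1 <-> dot x x = 1.
Proof.
have -> : enorm x = Num.sqrt (dot x x).
  by congr Num.sqrt; apply: eq_bigr => a _; rewrite big_ord1 expr2.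
split=> [h|->]; last exact: sqrtr1.
by rewrite -[LHS]sqr_sqrtr ?dot_sqr_ge0 // h expr1n.
Qed.

Lemma enorm_entry m n (A : 'M[R]_(m, n)) a b : `|A a b| <= enorm A.
Proof.
rewrite -sqrtr_sqr ler_wsqrtr // (bigD1 a) //= (bigD1 b) //= -addrA.
by rewrite lerDl addr_ge0 // !sumr_ge0 // => i _;
  rewrite ?sqr_ge0 ?sumr_ge0 // => j _; rewrite sqr_ge0.
Qed.

Lemma enorm_le m n (A : 'M[R]_(m, n)) k : 0 <= k ->
  (forall a b, `|A a b| <= k) -> enorm A <= Num.sqrt (m * n)%:R * k.
Proof.
move=> k0 h; rewrite -[X in _ * X]ger0_norm // -sqrtr_sqr -sqrtrM ?ler0n //.
rewrite ler_wsqrtr //.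
apply: (@le_trans _ _ (\sum_(a < m) \sum_(b < n) k ^+ 2)).
  apply: ler_sum => a _; apply: ler_sum => b _.
  by rewrite -[X in X <= _]real_normK ?num_real // ler_sqr ?nnegrE.
by rewrite !sumr_const !card_ord -mulrnA mulr_natl mulnC.
Qed.

Lemma normr_le_factor (a b w k : R) : 0 < w -> w <= b -> `|a * b| <= k * w -> `|a| <= k.
Proof.
move=> w0 wb; rewrite normrM [`|b|]ger0_norm; last by lra.
have := normr_ge0 a; move=> a0 h.
have : `|a| * w <= k * w by apply: le_trans h; rewrite ler_wpM2l.
by rewrite ler_pM2r.
Qed.

(** The vector is p x0 + q x1, where q rescales the component of x1 orthogonal to
x0 to its length in a tetrahedron.  Both p and q - 1 are of the order of the
gap, since q ^ 2 is a rational function of the cosine that equals 1 at -1/3. *)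
Lemma correct_second x0 x1 (m : R) : 0 <= m <= 100^-1 ->
  dot x0 x0 = 1 -> dot x1 x1 = 1 -> `|dot x0 x1 + 3^-1| <= m ->
  exists b, [/\ dot b b = 1, dot x0 b = - 3^-1 &
    forall a, `|x1 a 0 - b a 0| <= 3 * m].
Proof.
move=> /andP[m0 m1] h0 h1 he.
have [e ce] : exists e, dot x0 x1 = e - 3^-1.
  by exists (dot x0 x1 + 3^-1); rewrite addrK.
rewrite ce subrK in he.
have e2 : `|e * e| <= 100^-1 * m.
  by rewrite normrM ler_pM // (le_trans he).
have D0 : 10^-1 * 8 < 8 / 9 + 2 / 3 * e - e * e.
  by move: he e2; rewrite !ler_norml; lra.
have D0' : 0 < 8 / 9 + 2 / 3 * e - e * e by lra.
pose q := Num.sqrt (8 / 9 / (8 / 9 + 2 / 3 * e - e * e)).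
have q0 : 0 <= q by exact: sqrtr_ge0.
have q2 : q ^+ 2 * (8 / 9 + 2 / 3 * e - e * e) = 8 / 9.
  by rewrite sqr_sqrtr ?divfK ?gt_eqF // divr_ge0 ?ltW // divr_ge0.
have q1 : `|q - 1| <= m.
  apply: (@normr_le_factor _ ((q + 1) * (8 / 9 + 2 / 3 * e - e * e)) (10^-1 * 8)); first lra.
    rewrite mulrDl mul1r; have := mulr_ge0 q0 (ltW D0'); lra.
  have -> : (q - 1) * ((q + 1) * (8 / 9 + 2 / 3 * e - e * e)) = e * e - 2 / 3 * e.
    transitivity (q ^+ 2 * (8 / 9 + 2 / 3 * e - e * e)
                  - (8 / 9 + 2 / 3 * e - e * e)); first by ring.
    by rewrite q2; ring.
  by move: he e2; rewrite !ler_norml; lra.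
have qe : `|(q - 1) * e| <= 100^-1 * m.
  by rewrite normrM ler_pM // (le_trans q1).
pose p := (q - 1) / 3 - q * e.
have p1 : `|p| <= 2 * m.
  have -> : p = (q - 1) / 3 - (q - 1) * e - e by rewrite /p; ring.
  by move: he q1 qe; rewrite !ler_norml; lra.
exists (p *: x0 + q *: x1); split.
- rewrite !dot_lin (dotC x1 x0) h0 h1 ce.
  transitivity (9^-1 + q ^+ 2 * (8 / 9 + 2 / 3 * e - e * e)); last by rewrite q2; lra.
  by rewrite /p; field.
- by rewrite !dot_lin h0 ce /p; field.
- move=> a; rewrite !mxE.
  have -> : x1 a 0 - (p * x0 a 0 + q * x1 a 0) =
    - ((q - 1) * x1 a 0) - p * x0 a 0 by ring.
  have A1 : `|(q - 1) * x1 a 0| <= m * 1 by rewrite normrM ler_pM // entry_le1.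
  have A2 : `|p * x0 a 0| <= 2 * m * 1 by rewrite normrM ler_pM // entry_le1.
  by move: A1 A2; rewrite !ler_norml; lra.
Qed.

(** As [correct_second], with t x2 corrected by a combination of b0 and b1: t
rescales the component of x2 orthogonal to b0 and b1, and r, s solve the 2 x 2
Gram system of b0 and b1.  The squared length of the orthogonal component is
2 / 3 - Q, and 2 / 3 in a tetrahedron. *)
Lemma correct_third b0 b1 x2 (d : R) : 0 <= d <= 10^-1 ->
  dot b0 b0 = 1 -> dot b1 b1 = 1 -> dot b0 b1 = - 3^-1 -> dot x2 x2 = 1 ->
  `|dot b0 x2 + 3^-1| <= d -> `|dot b1 x2 + 3^-1| <= d ->
  exists b, [/\ dot b b = 1, dot b0 b = - 3^-1, dot b1 b = - 3^-1 &
    forall a, `|x2 a 0 - b a 0| <= 17 * d].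
Proof.
move=> /andP[d0 d1] h0 h1 h01 h2 he hf.
have [e ce] : exists e, dot b0 x2 = e - 3^-1.
  by exists (dot b0 x2 + 3^-1); rewrite addrK.
have [f cf] : exists f, dot b1 x2 = f - 3^-1.
  by exists (dot b1 x2 + 3^-1); rewrite addrK.
rewrite ce subrK in he; rewrite cf subrK in hf.
have e2 : `|e * e| <= 10^-1 * d by rewrite normrM ler_pM // (le_trans he).
have f2 : `|f * f| <= 10^-1 * d by rewrite normrM ler_pM // (le_trans hf).
have ef : `|e * f| <= 10^-1 * d by rewrite normrM ler_pM // (le_trans he).
pose Q := 9 / 8 * (e * e + f * f + 2 / 3 * (e * f) - 8 / 9 * (e + f)).
have Q1 : `|Q| <= 12 / 5 * d.
  by move: he hf e2 f2 ef; rewrite /Q !ler_norml; lra.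
have D0 : 2 / 5 <= 2 / 3 - Q by move: Q1; rewrite !ler_norml; lra.
have D0' : 0 < 2 / 3 - Q by lra.
pose t := Num.sqrt (2 / 3 / (2 / 3 - Q)).
have t0 : 0 <= t by exact: sqrtr_ge0.
have t2 : t ^+ 2 * (2 / 3 - Q) = 2 / 3.
  by rewrite sqr_sqrtr ?divfK ?gt_eqF // divr_ge0 ?ltW // divr_ge0.
have t1 : `|t - 1| <= 6 * d.
  apply: (@normr_le_factor _ ((t + 1) * (2 / 3 - Q)) (2 / 5)); first lra.
    rewrite mulrDl mul1r; have := mulr_ge0 t0 (ltW D0'); lra.
  have -> : (t - 1) * ((t + 1) * (2 / 3 - Q)) = Q.
    by transitivity (t ^+ 2 * (2 / 3 - Q) - (2 / 3 - Q)); [ring | rewrite t2; ring].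
  by move: Q1; rewrite !ler_norml; lra.
have te : `|(t - 1) * e| <= 6 / 10 * d.
  rewrite normrM (le_trans (ler_pM _ _ t1 he)) //.
  have : d * d <= 10^-1 * d by rewrite ler_wpM2r.
  lra.
have tf : `|(t - 1) * f| <= 6 / 10 * d.
  rewrite normrM (le_trans (ler_pM _ _ t1 hf)) //.
  have : d * d <= 10^-1 * d by rewrite ler_wpM2r.
  lra.
pose A := (t - 1) / 3 - t * e; pose B := (t - 1) / 3 - t * f.
have A1 : `|A| <= 18 / 5 * d.
  have -> : A = (t - 1) / 3 - (t - 1) * e - e by rewrite /A; ring.
  by move: he t1 te; rewrite !ler_norml; lra.
have B1 : `|B| <= 18 / 5 * d.
  have -> : B = (t - 1) / 3 - (t - 1) * f - f by rewrite /B; ring.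
  by move: hf t1 tf; rewrite !ler_norml; lra.
pose r := 9 / 8 * (A + B / 3); pose s := 9 / 8 * (A / 3 + B).
have r1 : `|r| <= 27 / 5 * d by move: A1 B1; rewrite /r !ler_norml; lra.
have s1 : `|s| <= 27 / 5 * d by move: A1 B1; rewrite /s !ler_norml; lra.
exists (t *: x2 + r *: b0 + s *: b1); split.
- rewrite !dot_lin (dotC x2 b0) (dotC x2 b1) (dotC b1 b0) h0 h1 h01 h2 ce cf.
  transitivity (3^-1 + t ^+ 2 * (2 / 3 - Q)); last by rewrite t2; lra.
  by rewrite /r /s /A /B /Q; field.
- by rewrite !dot_lin h0 h01 ce /r /s /A /B; field.
- by rewrite !dot_lin (dotC b1 b0) h1 h01 cf /r /s /A /B; field.
- move=> a; rewrite !mxE.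
  have -> : x2 a 0 - (t * x2 a 0 + r * b0 a 0 + s * b1 a 0) =
    - ((t - 1) * x2 a 0) - r * b0 a 0 - s * b1 a 0 by ring.
  have C1 : `|(t - 1) * x2 a 0| <= 6 * d * 1 by rewrite normrM ler_pM // entry_le1.
  have C2 : `|r * b0 a 0| <= 27 / 5 * d * 1 by rewrite normrM ler_pM // entry_le1.
  have C3 : `|s * b1 a 0| <= 27 / 5 * d * 1 by rewrite normrM ler_pM // entry_le1.
  by move: C1 C2 C3; rewrite !ler_norml; lra.
Qed.

(** The Gram matrix of b0, b1, b2 is (4/3) I - (1/3) J with inverse
(3/4) (I + J), J being the all-ones matrix; this yields a one-sided inverse of
the matrix with rows b0, b1, b2, which for a square matrix is two-sided. *)
Lemma tight_frame b0 b1 b2 y :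
  dot b0 b0 = 1 -> dot b1 b1 = 1 -> dot b2 b2 = 1 ->
  dot b0 b1 = - 3^-1 -> dot b0 b2 = - 3^-1 -> dot b1 b2 = - 3^-1 ->
  let b3 := - (b0 + b1 + b2) in
  y = (3 / 4) *: (dot b0 y *: b0 + dot b1 y *: b1 + dot b2 y *: b2 + dot b3 y *: b3).
Proof.
move=> h0 h1 h2 h01 h02 h12 b3.
pose A : 'M[R]_3 := \matrix_(i, a) nth 0 [:: b0; b1; b2] i a 0.
pose A' : 'M[R]_3 := \matrix_(a, i)
  ((3 / 4) * (nth 0 [:: b0; b1; b2] i a 0 + (b0 + b1 + b2) a 0)).
(* the columns of A' are the dual basis of b0, b1, b2 *)
have AA : A *m A' = 1%:M.
  apply/matrixP => i j; rewrite !mxE.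
  transitivity (3 / 4 * dot (nth 0 [:: b0; b1; b2] i)
     (nth 0 [:: b0; b1; b2] j + (b0 + b1 + b2))).
    rewrite /dot mulr_sumr; apply: eq_bigr => a _; rewrite !mxE; ring.
  case: i => -[|[|[|//]]] Hi; case: j => -[|[|[|//]]] Hj /=;
   rewrite !dot_lin ?(dotC b1 b0) ?(dotC b2 b0) ?(dotC b2 b1) ?h0 ?h1 ?h2 ?h01 ?h02 ?h12
     -?val_eqE /= ?mulr1n ?mulr0n; field => //.
have := mulmx1C AA => /(congr1 (mulmx^~ y)); rewrite mul1mx => {1}<-.
rewrite -mulmxA.
apply/matrixP => a b; rewrite [b]ord1 mxE.
transitivity (\sum_i A' a i * dot (nth 0 [:: b0; b1; b2] i) y).
  apply: eq_bigr => i _; congr (_ * _); rewrite mxE.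
  by apply: eq_bigr => c _; rewrite mxE.
rewrite !big_ord_recl big_ord0 /= !mxE /= !dot_lin; ring.
Qed.

End Dot.

(** * Gaps and the distance to the tetrahedra *)

Section Near.
Context {R : realType}.
Implicit Types (G B : config R) (x y z : 'cV[R]_3).

Definition config_of (b : 'I_4 -> 'cV[R]_3) : config R := \matrix_(a, i) b i a 0.

Lemma agent_config_of b i : agent (config_of b) i = b i.
Proof. by apply/matrixP => a c; rewrite [c]ord1 !mxE. Qed.

Lemma ord4P (P : 'I_4 -> Prop) : P 0 -> P 1 -> P 2%:R -> P 3%:R -> forall i, P i.
Proof.
move=> P0 P1 P2 P3; case=> -[|[|[|[|//]]]] Hi.
- by rewrite (_ : Ordinal Hi = 0) //; exact: val_inj.
- by rewrite (_ : Ordinal Hi = 1) //; exact: val_inj.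
- by rewrite (_ : Ordinal Hi = 2%:R) //; exact: val_inj.
- by rewrite (_ : Ordinal Hi = 3%:R) //; exact: val_inj.
Qed.

Lemma tetrahedra_of (b0 b1 b2 : 'cV[R]_3) :
  dot b0 b0 = 1 -> dot b1 b1 = 1 -> dot b2 b2 = 1 ->
  dot b0 b1 = - 3^-1 -> dot b0 b2 = - 3^-1 -> dot b1 b2 = - 3^-1 ->
  tetrahedra (config_of (fun i => nth 0 [:: b0; b1; b2; - (b0 + b1 + b2)] i)).
Proof.
move=> h0 h1 h2 h01 h02 h12; split.
  move=> i; rewrite agent_config_of enorm_unit; move: i.
  apply: ord4P => //=; rewrite !dot_lin (dotC b1 b0) (dotC b2 b0) (dotC b2 b1).
  by rewrite h0 h1 h2 h01 h02 h12; field.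
move=> i j; rewrite !agent_config_of; move: i j.
by apply: ord4P; apply: ord4P => //= _; rewrite ?dot_lin
  ?(dotC b1 b0) ?(dotC b2 b0) ?(dotC b2 b1) ?h0 ?h1 ?h2 ?h01 ?h02 ?h12 //; field.
Qed.

Lemma dot_near x (b : 'cV[R]_3) y (k : R) : dot y y = 1 ->
  (forall a, `|x a 0 - b a 0| <= k) -> `|dot b y - dot x y| <= 3 * k.
Proof.
move=> hy hk; rewrite -dotNl -dotDl -[k]mulr1; apply: dot_le => a.
  by rewrite !mxE distrC.
exact: entry_le1.
Qed.

Definition gap G (i j : 'I_4) : R := dot (agent G i) (agent G j) + 3^-1.

(** The first vector is kept, the second and third are corrected, and the fourth
is minus their sum.  Its distance to the fourth agent is read off in the tight
frame formed by the tetrahedron: all coordinates of the difference are of the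
order of the gaps. *)
Lemma near_tetrahedra G (m : R) : S2_4 G -> 0 <= m <= 100^-1 ->
  (forall i j, i != j -> `|gap G i j| <= m) ->
  exists2 B, tetrahedra B & forall a i, `|G a i - B a i| <= 2400 * m.
Proof.
rewrite /gap => hG /[dup] hm /andP[m0 m1] he.
have hu i : dot (agent G i) (agent G i) = 1 by apply/enorm_unit.
set b0 := agent G 0.
have h00 : dot b0 b0 = 1 by exact: hu.
have [b1 [h11 h01 d1]] : exists b, [/\ dot b b = 1, dot b0 b = - 3^-1 &
    forall a, `|agent G 1 a 0 - b a 0| <= 3 * m].
  by apply: correct_second => //; exact: (he 0 1 isT).
have e2 : `|dot b1 (agent G 2%:R) + 3^-1| <= 10 * m.
  have := dot_near _ _ _ _ (hu 2%:R) d1; have := he 1 2%:R isT.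
  by rewrite !ler_norml; lra.
have [b2 [h22 h02 h12 d2]] : exists b, [/\ dot b b = 1, dot b0 b = - 3^-1,
    dot b1 b = - 3^-1 & forall a, `|agent G 2%:R a 0 - b a 0| <= 17 * (10 * m)].
  apply: correct_third => //; first lra.
  by apply: le_trans (he 0 2%:R isT) _; lra.
exists (config_of (fun i => nth 0 [:: b0; b1; b2; - (b0 + b1 + b2)] i)).
  exact: tetrahedra_of.
(* y is the difference between the fourth agent and the fourth vertex *)
pose y := agent G 3%:R + (b0 + b1 + b2).
have E0 : `|dot b0 y| <= 511 * m.
  rewrite /y !dot_lin h00 h01 h02.
  by have := he 0 3%:R isT; rewrite -/b0 !ler_norml; lra.
have E1 : `|dot b1 y| <= 511 * m.
  rewrite /y !dot_lin (dotC b1 b0) h11 h01 h12.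
  have := dot_near _ _ _ _ (hu 3%:R) d1; have := he 1 3%:R isT.
  by rewrite !ler_norml; lra.
have E2 : `|dot b2 y| <= 511 * m.
  rewrite /y !dot_lin (dotC b2 b0) (dotC b2 b1) h22 h02 h12.
  have := dot_near _ _ _ _ (hu 3%:R) d2; have := he 2%:R 3%:R isT.
  by rewrite !ler_norml; lra.
have E3 : `|dot (- (b0 + b1 + b2)) y| <= 1533 * m.
  by rewrite dotNl !dotDl; move: E0 E1 E2; rewrite !ler_norml; lra.
have tG a (i : 'I_4) : G a i = agent G i a 0 by rewrite mxE.
move=> a i; rewrite tG [X in _ - X]mxE; move: i; apply: ord4P => /=.
- by rewrite subrr normr0; lra.
- by apply: le_trans (d1 a) _; lra.
- by apply: le_trans (d2 a) _; lra.
have -> : agent G 3%:R a 0 - (- (b0 + b1 + b2)) a 0 = y a 0 by rewrite !mxE; ring.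
have h33 : dot (- (b0 + b1 + b2)) (- (b0 + b1 + b2)) = 1.
  by rewrite !dot_lin (dotC b1 b0) (dotC b2 b0) (dotC b2 b1) h00 h11 h22 h01 h02 h12; field.
rewrite (tight_frame _ _ _ y h00 h11 h22 h01 h02 h12).
have P b k : dot b b = 1 -> `|dot b y| <= k -> `|(dot b y *: b) a 0| <= k.
  by move=> hb hk; rewrite mxE normrM -[k]mulr1 ler_pM // entry_le1.
move: (P _ _ h00 E0) (P _ _ h11 E1) (P _ _ h22 E2) (P _ _ h33 E3).
set p0 := _ *: b0; set p1 := _ *: b1; set p2 := _ *: b2; set p3 := _ *: _.
have -> : ((3 / 4) *: (p0 + p1 + p2 + p3)) a 0 =
  3 / 4 * (p0 a 0 + p1 a 0 + p2 a 0 + p3 a 0) by rewrite !mxE.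
by rewrite !ler_norml; lra.
Qed.

Lemma tetrahedra_nonempty : exists B : config R, tetrahedra B.
Proof.
pose s : R := Num.sqrt 3^-1.
have s2 : s * s = 3^-1 by rewrite -expr2 sqr_sqrtr.
pose v (e1 e2 e3 : R) : 'cV[R]_3 := \col_a (s * nth 0 [:: e1; e2; e3] a).
have vE e1 e2 e3 f1 f2 f3 : dot (v e1 e2 e3) (v f1 f2 f3) = 3^-1 * (e1 * f1 + e2 * f2 + e3 * f3).
  by rewrite dotE !mxE /= -s2; ring.
exists (config_of (fun i => nth 0 [:: v 1 1 1; v 1 (-1) (-1); v (-1) 1 (-1);
  - (v 1 1 1 + v 1 (-1) (-1) + v (-1) 1 (-1))] i)).
by apply: tetrahedra_of; rewrite vE; field.
Qed.

Lemma gap_le_enorm G B i j : S2_4 G -> tetrahedra B -> i != j ->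
  `|gap G i j| <= 6 * enorm (G - B).
Proof.
rewrite /gap => hG [hB1 hB2] ij.
have hu (k : 'I_4) : dot (agent G k) (agent G k) = 1 by apply/enorm_unit.
have hv k : dot (agent B k) (agent B k) = 1 by apply/enorm_unit.
have hk k a : `|agent G k a 0 - agent B k a 0| <= enorm (G - B).
  by have := enorm_entry _ _ (G - B) a k; rewrite !mxE.
have hk' k a : `|agent B k a 0 - agent G k a 0| <= enorm (G - B).
  by rewrite distrC.
have := dot_near _ _ _ _ (hu j) (hk i); have := dot_near _ _ _ _ (hv i) (hk j).
rewrite (dotC _ (agent B i)) (dotC _ (agent B i)) hB2 //.
by rewrite !ler_norml; lra.
Qed.

Lemma gap_le_edist_set G i j : S2_4 G -> i != j ->
  `|gap G i j| <= 6 * edist_set G tetrahedra.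
Proof.
move=> hG ij; rewrite -ler_pdivrMl //; apply: lb_le_inf.
  by have [B hB] := tetrahedra_nonempty; exists (enorm (G - B)), B.
by move=> _ [B hB <-]; rewrite ler_pdivrMl //; exact: gap_le_enorm.
Qed.

Lemma edist_set_le G (m : R) : S2_4 G -> 0 <= m <= 100^-1 ->
  (forall i j, i != j -> `|gap G i j| <= m) ->
  edist_set G tetrahedra <= Num.sqrt 12 * (2400 * m).
Proof.
move=> hG hm he; have [B hB hGB] := near_tetrahedra _ _ hG hm he.
apply: (@le_trans _ _ (enorm (G - B))); last first.
  apply: (@enorm_le _ 3 4); first by case/andP: hm => m0 _; lra.
  by move=> a i; rewrite !mxE.
apply: ge_inf; last by exists B.
by exists 0 => _ [C _ <-]; exact: sqrtr_ge0.
Qed.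

Lemma uniq4P (T : eqType) (i0 i1 i2 i3 : T) : uniq [:: i0; i1; i2; i3] ->
  [/\ i0 != i1, i0 != i2 & i0 != i3] /\ [/\ i1 != i2, i2 != i3 & i3 != i1].
Proof.
rewrite /= !inE !negb_or (eq_sym i3).
by move=> /andP[/and3P[-> -> ->] /andP[/andP[-> ->] /andP[-> _]]].
Qed.

Lemma tetrahedra_sum0 B i0 i1 i2 i3 : uniq [:: i0; i1; i2; i3] -> tetrahedra B ->
  agent B i0 + agent B i1 + agent B i2 + agent B i3 = 0.
Proof.
move=> /uniq4P[[n1 n2 n3] [n4 n5 n6]] [hB1 hB2]; apply: dot0_eq0.
have hv k : dot (agent B k) (agent B k) = 1 by apply/enorm_unit.
by rewrite !dot_lin !hv !hB2 //; [field | rewrite eq_sym ..].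
Qed.

(** The sum of the gaps is half the squared length of the sum S of the agents,
and S is the difference between the agents and a nearby tetrahedron, whose
vector sum is zero.  It is the trace left, near the tetrahedra, by the
singularity of the Gram matrix of four vectors in dimension three. *)
Lemma gap_sum_le G (m : R) i0 i1 i2 i3 : uniq [:: i0; i1; i2; i3] -> S2_4 G -> 0 <= m <= 100^-1 ->
  (forall i j, i != j -> `|gap G i j| <= m) ->
  `|gap G i0 i1 + gap G i0 i2 + gap G i0 i3
    + gap G i1 i2 + gap G i2 i3 + gap G i3 i1|
    <= 3 / 2 * (9600 ^+ 2 * (m * m)).
Proof.
move=> u hG hm he; have [B hB hGB] := near_tetrahedra _ _ hG hm he.
have hu k : dot (agent G k) (agent G k) = 1 by apply/enorm_unit.
pose S := agent G i0 + agent G i1 + agent G i2 + agent G i3.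
have -> : gap G i0 i1 + gap G i0 i2 + gap G i0 i3
    + gap G i1 i2 + gap G i2 i3 + gap G i3 i1 = 2^-1 * dot S S.
  rewrite /gap /S !dot_lin !hu.
  rewrite (dotC (agent G i1) (agent G i0)) (dotC (agent G i2) (agent G i0)).
  rewrite (dotC (agent G i2) (agent G i1)) (dotC (agent G i3) (agent G i0)).
  rewrite (dotC (agent G i3) (agent G i1)) (dotC (agent G i3) (agent G i2)).
  by field.
have hS a : `|S a 0| <= 9600 * m.
  rewrite -[S]subr0 -(tetrahedra_sum0 _ _ _ _ _ u hB) !mxE.
  move: (hGB a i0) (hGB a i1) (hGB a i2) (hGB a i3).
  by rewrite !ler_norml; lra.
have := dot_le _ _ _ _ hS hS; rewrite normrM [`|2^-1|]ger0_norm //; lra.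
Qed.
End Near.

(** * The tetrahedra form a submanifold *)

Section Poly.
Context {R : realType} {m n : nat}.
Local Notation V := 'M[R]_(m, n).

(** An inductive closure rather than polynomials: it is stable under directional
derivatives, so that smoothness follows by induction on the order. *)
Inductive entry_poly : (V -> R) -> Prop :=
| EPcst c : entry_poly (cst c)
| EPentry a i : entry_poly (fun G => G a i)
| EPadd g h : entry_poly g -> entry_poly h -> entry_poly (g + h)
| EPmul g h : entry_poly g -> entry_poly h -> entry_poly (g * h).

Lemma is_derive_entry a i (G v : V) : is_derive G v (fun G : V => G a i) (v a i).
Proof.
apply: DeriveDef; first exact/diff_derivable/differentiable_coord.
have D : derivable (@id V) G v by exact: derivable_id.
have /matrixP/(_ a i) := derive_mx D.
by rewrite derive_id mxE.
Qed.

Lemma entry_poly_differentiable g : entry_poly g -> forall x, differentiable g x.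
Proof.
elim=> [c|a i|g1 g2 _ h1 _ h2|g1 g2 _ h1 _ h2] x.
- exact: differentiable_cst.
- exact: differentiable_coord.
- exact: differentiableD.
- exact: differentiableM.
Qed.

Lemma entry_poly_derive g v : entry_poly g -> entry_poly (fun x => 'D_v g x).
Proof.
elim=> [c|a i|g1 g2 p1 h1 p2 h2|g1 g2 p1 h1 p2 h2].
- by rewrite (_ : (fun _ => _) = cst 0); [exact: EPcst | apply/funext => x; rewrite derive_cst].
- rewrite (_ : (fun _ => _) = cst (v a i)); first exact: EPcst.
  by apply/funext => x; have := is_derive_entry a i x v; move=> H; rewrite derive_val.
- rewrite (_ : (fun _ => _) = (fun x => 'D_v g1 x) + (fun x => 'D_v g2 x)); first exact: EPadd.
  by apply/funext => x; rewrite deriveD //; apply/diff_derivable/entry_poly_differentiable.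
- rewrite (_ : (fun _ => _) = g1 * (fun x => 'D_v g2 x) + g2 * (fun x => 'D_v g1 x)).
    by apply: EPadd; exact: EPmul.
  by apply/funext => x; rewrite deriveM //; apply/diff_derivable/entry_poly_differentiable.
Qed.

Lemma entry_poly_smooth g U : entry_poly g -> smooth_on U g.
Proof.
move=> pg k; elim: k g pg => [|k IH] g pg /=.
  by move=> x _; apply: differentiable_continuous; exact: entry_poly_differentiable.
split=> [x _|v]; first exact: entry_poly_differentiable.
by apply: IH; exact: entry_poly_derive.
Qed.

Lemma entry_poly_sum (I : Type) (r : seq I) (g : I -> V -> R) :
  (forall i, entry_poly (g i)) -> entry_poly (fun G => \sum_(i <- r) g i G).
Proof.
move=> h; elim: r => [|i r IH].
  rewrite (_ : (fun _ => _) = cst 0); first exact: EPcst.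
  by apply/funext => G; rewrite big_nil.
rewrite (_ : (fun _ => _) = g i + (fun G => \sum_(i <- r) g i G)); first exact: EPadd.
by apply/funext => G; rewrite big_cons.
Qed.
End Poly.

Section Tetra.
Context {R : realType}.
Local Notation V := (config R).

Definition dot_constraint (i j : 'I_4) (c : R) : V -> R :=
  (fun G : V => \sum_(a < 3)
     (((fun G : V => G a i) : V -> R) * (fun G : V => G a j)) G) + cst (- c).

Definition sum_coord (a : 'I_3) : V -> R := fun G : V => \sum_(i < 4) G a i.

(** The ten natural equations (four norms and six inner products) have dependent
differentials along the tetrahedra, whereas these nine are independent there. *)
Definition tetra_eqs : seq (V -> R) :=
  [:: sum_coord 0; sum_coord 1; sum_coord 2%:R; dot_constraint 0 0 1; dot_constraint 1 1 1;
      dot_constraint 2%:R 2%:R 1; dot_constraint 0 1 (- 3^-1); dot_constraint 0 2%:R (- 3^-1);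
      dot_constraint 1 2%:R (- 3^-1)].

Lemma dot_constraintE i j c G : dot_constraint i j c G = dot (agent G i) (agent G j) - c.
Proof.
by rewrite /dot_constraint /dot !fctE; congr (_ - _); apply: eq_bigr => a _; rewrite !mxE.
Qed.

Lemma entry_poly_pair i j c : entry_poly (dot_constraint i j c).
Proof.
apply: EPadd; last exact: EPcst.
by apply: entry_poly_sum => a; apply: EPmul; exact: EPentry.
Qed.

Lemma entry_poly_sum_coord a : entry_poly (sum_coord a).
Proof. by apply: entry_poly_sum => i; exact: EPentry. Qed.

Lemma derive_pair i j c (G v : V) : 'D_v (dot_constraint i j c) G =
  dot (agent v i) (agent G j) + dot (agent G i) (agent v j).
Proof.
rewrite (_ : dot_constraint i j c = \sum_(a < 3)
  (((fun G : V => G a i) : V -> R) * (fun G : V => G a j)) + cst (- c)); last first.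
  by apply/funext => x; rewrite /dot_constraint !fctE fct_sumE.
have D a i := is_derive_entry a i G v.
rewrite derive_val.
rewrite subr0 /dot -big_split /=; apply: eq_bigr => a _; rewrite !mxE /GRing.scale /=.
by rewrite addrC; congr (_ + _); exact: mulrC.
Qed.

Lemma derive_sum_coord a (G v : V) : 'D_v (sum_coord a) G = \sum_(i < 4) v a i.
Proof.
rewrite (_ : sum_coord a = \sum_(i < 4) (fun G : V => G a i)); last first.
  by apply/funext => x; rewrite fct_sumE.
have D b i := is_derive_entry b i G v.
by rewrite derive_val.
Qed.

Lemma tetrahedraP (G : V) :
  tetrahedra G <-> forall i : 'I_9, nth (cst 0) tetra_eqs i G = 0.
Proof.
have sumE a : sum_coord a G =
    (agent G 0 + agent G 1 + agent G 2%:R + agent G 3%:R) a 0.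
  rewrite /sum_coord !big_ord_recl big_ord0 !mxE addr0 !addrA.
  by do ![congr (_ + _)]; congr fun_of_matrix; exact: val_inj.
split=> [hG|h].
  have hu k : dot (agent G k) (agent G k) = 1 by case: hG => hG _; apply/enorm_unit.
  have hp i j : i != j -> dot (agent G i) (agent G j) = - 3^-1.
    by case: hG => _; exact.
  case=> n hn /=; do 9 (case: n hn => [_|n hn]; first by rewrite /= ?dot_constraintE ?sumE
    ?(tetrahedra_sum0 _ 0 1 2%:R 3%:R) ?mxE ?hu ?hp ?subrr).
  by [].
have s0 a : (agent G 0 + agent G 1 + agent G 2%:R + agent G 3%:R) a 0 = 0.
  rewrite -sumE; case: a => -[|[|[|//]]] Ha.
  - by have := h (inord 0); rewrite inordK //= => <-; congr (sum_coord _ G); exact: val_inj.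
  - by have := h (inord 1); rewrite inordK //= => <-; congr (sum_coord _ G); exact: val_inj.
  - by have := h (inord 2); rewrite inordK //= => <-; congr (sum_coord _ G); exact: val_inj.
have {}s0 : agent G 3%:R = - (agent G 0 + agent G 1 + agent G 2%:R).
  apply/eqP; rewrite -addr_eq0 addrC; apply/eqP.
  by apply/matrixP => a b; rewrite [b]ord1 s0 mxE.
have E i : (i < 9)%N -> nth (cst 0) tetra_eqs i G = 0.
  by move=> i9; have := h (Ordinal i9).
have h00 := E 3%N isT; have h11 := E 4%N isT; have h22 := E 5%N isT.
have h01 := E 6%N isT; have h02 := E 7%N isT; have h12 := E 8%N isT.
rewrite /= !dot_constraintE in h00 h11 h22 h01 h02 h12.
have <- : config_of (fun i => nth 0 [:: agent G 0; agent G 1; agent G 2%:R;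
  - (agent G 0 + agent G 1 + agent G 2%:R)] i) = G.
  apply/matrixP => a i; rewrite mxE -s0; move: i.
  by apply: ord4P; rewrite /= mxE.
by apply: tetrahedra_of; lra.
Qed.

(** The Gram matrix of three vectors of a tetrahedron is invertible. *)
Lemma gram_independent (x0 x1 x2 : 'cV[R]_3) (a b c : R) :
  dot x0 x0 = 1 -> dot x1 x1 = 1 -> dot x2 x2 = 1 ->
  dot x0 x1 = - 3^-1 -> dot x0 x2 = - 3^-1 -> dot x1 x2 = - 3^-1 ->
  (forall w, a * dot x0 w + b * dot x1 w + c * dot x2 w = 0) ->
  [/\ a = 0, b = 0 & c = 0].
Proof.
move=> h0 h1 h2 h01 h02 h12 h.
move: (h x0) (h x1) (h x2).
rewrite (dotC x1 x0) (dotC x2 x0) (dotC x2 x1) h0 h1 h2 h01 h02 h12.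
by split; lra.
Qed.

(** In a combination of the nine differentials that vanishes, moving only the
fourth agent isolates the three equations of the vector sum; then moving one of
the other agents isolates the equations in which it occurs, and these have
independent gradients. *)
Lemma tetrahedra_submanifold : submanifold 9 (tetrahedra : set V).
Proof.
move=> G _; exists setT, (fun i : 'I_9 => nth (cst 0) tetra_eqs i); split.
- exact: openT.
- by [].
- move=> i; apply: entry_poly_smooth; move: i.
  case=> n hn /=; do 9 (case: n hn => [_|n hn];
    first by [exact: entry_poly_sum_coord | exact: entry_poly_pair]).
  by [].
- by move=> y _; exact: tetrahedraP.
move=> y _ hy a ha.
have hu k : dot (agent y k) (agent y k) = 1 by case: hy => hy _; apply/enorm_unit.
have hp i j : i != j -> dot (agent y i) (agent y j) = - 3^-1.
  by case: hy => _; exact.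
pose A i := a (inord i).
have H (v : 'I_4 -> 'cV[R]_3) (q := fun i j : 'I_4 =>
    dot (v i) (agent y j) + dot (agent y i) (v j))
    (s := fun c : 'I_3 => v 0 c 0 + v 1 c 0 + v 2%:R c 0 + v 3%:R c 0) :
    A 0%N * s 0 + A 1%N * s 1 + A 2%N * s 2%:R + A 3%N * q 0 0 + A 4%N * q 1 1
    + A 5%N * q 2%:R 2%:R + A 6%N * q 0 1 + A 7%N * q 0 2%:R + A 8%N * q 1 2%:R = 0.
  rewrite -[RHS](ha (config_of v)).
  rewrite !big_ord_recl big_ord0 addr0 !addrA.
  have sE c : 'D_(config_of v) (sum_coord c) y = s c.
    rewrite derive_sum_coord !big_ord_recl big_ord0 !mxE addr0 !addrA /s.
    by do ![congr (_ + _)]; congr (v _ _ _); exact: val_inj.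
  have qE i j c : 'D_(config_of v) (dot_constraint i j c) y = q i j.
    by rewrite derive_pair !agent_config_of.
  have aE i (hi : (i < 9)%N) o : nat_of_ord o = i -> a o = A i.
    by move=> ho; rewrite /A; congr a; apply: val_inj; rewrite /= inordK.
  have T i (hi : (i < 9)%N) o d e : nat_of_ord o = i -> d = e -> A i * e = a o * d.
    by move=> ho ->; rewrite (aE i).
  by do 8 (congr (_ + _); last by apply: T => //=; rewrite ?sE ?qE); apply: T => //=; rewrite sE.
(* only agent k moves, in the direction w *)
pose only (k : 'I_4) (w : 'cV[R]_3) := fun i : 'I_4 => if i == k then w else 0.
have d0 x : dot 0 x = 0 by rewrite -[0](scale0r x) dotZl mul0r.
have d0' x : dot x 0 = 0 by rewrite dotC d0.
have [A0 A1 A2] : [/\ A 0%N = 0, A 1%N = 0 & A 2%N = 0].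
  have K (c : 'I_3) := H (only 3%:R (delta_mx c 0)).
  move: (K 0) (K 1) (K 2%:R); rewrite /only /= !d0 !d0' !mxE /=.
  by split; lra.
have K k w := H (only k w); rewrite A0 A1 A2 /only in K.
have gi := gram_independent (agent y 0) (agent y 1) (agent y 2%:R) _ _ _
  (hu 0) (hu 1) (hu 2%:R) (hp 0 1 isT) (hp 0 2%:R isT) (hp 1 2%:R isT).
have [A3 A6 A7] : [/\ 2 * A 3%N = 0, A 6%N = 0 & A 7%N = 0].
  apply: gi => w; rewrite -[RHS](K 0 w) /= !d0 !d0' !(dotC w); ring.
have [_ A4 A8] : [/\ A 6%N = 0, 2 * A 4%N = 0 & A 8%N = 0].
  apply: gi => w; rewrite -[RHS](K 1 w) /= !d0 !d0' !(dotC w); ring.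
have [_ _ A5] : [/\ A 7%N = 0, A 8%N = 0 & 2 * A 5%N = 0].
  apply: gi => w; rewrite -[RHS](K 2%:R w) /= !d0 !d0' !(dotC w); ring.
move=> i; rewrite -[i]inord_val -/(A i); case: i => n hn /=.
do 9 (case: n hn => [_|n hn]; first by lra).
by [].
Qed.
End Tetra.

(** * The interaction profile and the labelling of the agents *)

(** First-order Taylor expansion at one point, in the form used by [lyap_decay]. *)
Lemma derive_expansion {R : realType} (g : R -> R) (x b : R) :
  is_derive x (1 : R) g b ->
  forall eta, 0 < eta -> exists2 d, 0 < d &
    forall e, `|e| <= d -> `|g (e + x) - g x - b * e| <= eta * `|e|.
Proof.
move=> [dg gb] eta eta0.
have : h^-1 *: (g (h *: 1 + x) - g x) @[h --> 0^'] --> b by rewrite -gb; exact: dg.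
move=> /cvgrPdist_le /(_ _ eta0) [d /= d0 hd].
exists (d / 2); first by rewrite divr_gt0.
move=> e he; have [->|e0] := eqVneq e 0.
  by rewrite add0r subrr mulr0 subr0 normr0 mulr0.
have := hd e; rewrite /ball_ /= sub0r normrN => /(_ _ e0).
rewrite /GRing.scale /= mulr1 => H.
have -> : g (e + x) - g x - b * e = - ((b - e^-1 * (g (e + x) - g x)) * e).
  by field.
rewrite normrN normrM ler_wpM2r //; apply: H.
by apply: le_lt_trans he _; rewrite ltr_pdivrMr // ltr_pMr // ltr1n.
Qed.

Lemma profile_expansion {R : realType} (f : R -> R) :
  (forall x : R, 0 < x < pi -> 0 < f x) ->
  (forall x : R, 0 < x < pi -> derivable f x 1 /\ derive1 f x < 0) ->
  exists beta gamma, [/\ 0 < beta, 0 < gamma &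
    forall eta, 0 < eta -> exists2 d, 0 < d &
     forall e, `|e| <= d ->
       `|f (acos (e - 3^-1)) - gamma - beta * e| <= eta * `|e|].
Proof.
move=> hpos hdec; pose x : R := - 3^-1.
have hx : -1 < x < 1 by rewrite /x; lra.
have ha : 0 < acos x < pi by rewrite acos_gt0 ?acos_ltpi //; lra.
have [df fneg] := hdec _ ha.
have s0 : 0 < (Num.sqrt (1 - x ^+ 2))^-1.
  by rewrite invr_gt0 sqrtr_gt0 /x; lra.
exists (derive1 f (acos x) * - (Num.sqrt (1 - x ^+ 2))^-1), (f (acos x)); split.
- by rewrite mulrN -mulNr mulr_gt0 // oppr_gt0.
- exact: hpos.
apply: (derive_expansion (f \o acos)).
have Ha := is_derive1_acos hx.
have Hf : is_derive (acos x) 1 f (derive1 f (acos x)).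
  by rewrite derive1E; exact: derivableP.
exact: is_derive1_comp.
Qed.

Lemma suc_skip_inj (k i j : 'I_4) :
  i != k -> j != k -> suc_skip k i = suc_skip k j -> i = j.
Proof.
by move: k i j; do 3 (apply: ord4P); move=> //= _ _ /(congr1 val).
Qed.

Lemma pre_skip_suc (k i : 'I_4) : i != k -> pre_skip k (suc_skip k i) = i.
Proof.
move=> ik; rewrite /pre_skip; case: pickP => [j /andP[jk /eqP]|/(_ i)].
  exact: suc_skip_inj.
by rewrite ik eqxx.
Qed.

Section Labels.
Context {R : realType}.
Implicit Types (G : config R).

(** The normal form of the weights: i0 is the hub, and the rim is the directed
cycle i1 -> i2 -> i3 -> i1. *)
Record hub_labels (w : 'I_4 -> 'I_4 -> R) (i0 i1 i2 i3 : 'I_4) : Prop := HubLabels {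
  hub_uniq : uniq [:: i0; i1; i2; i3];
  hub_out : forall j, w i0 j = 2^-1;
  hub_in : forall j, w j i0 = 2^-1;
  hub_next : [/\ w i1 i2 = 1, w i2 i3 = 1 & w i3 i1 = 1];
  hub_prev : [/\ w i2 i1 = 0, w i3 i2 = 0 & w i1 i3 = 0] }.

Lemma hub_rot w i0 i1 i2 i3 : hub_labels w i0 i1 i2 i3 -> hub_labels w i0 i2 i3 i1.
Proof.
move=> [u o i [n1 n2 n3] [p1 p2 p3]]; split => //.
rewrite -(perm_uniq (s1 := [:: i0; i1; i2; i3])) // perm_cons perm_sym.
by rewrite -[X in perm_eq X _]/(rot 1 [:: i1; i2; i3]) perm_rot.
Qed.

(** For p = 1 the rim follows the order k + 1, k + 2, k + 3, and for p = 0 it is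
traversed backwards. *)
Lemma weight_hub (k : 'I_4) (p : R) : p = 0 \/ p = 1 ->
  exists i1 i2 i3, hub_labels (weight k p) k i1 i2 i3.
Proof.
have ho j : weight k p k j = 2^-1 by rewrite /weight eqxx.
have hi j : weight k p j k = 2^-1 by rewrite /weight eqxx orbT.
have hs i : i != k -> suc_skip k i != k -> weight k p i (suc_skip k i) = p.
  by move=> ik sk; rewrite /weight ![k == _]eq_sym (negbTE ik) (negbTE sk) /= eqxx.
have hp i : i != k -> suc_skip k i != k -> suc_skip k (suc_skip k i) != i ->
     weight k p (suc_skip k i) i = 1 - p.
  move=> ik sk ssk; rewrite /weight ![k == _]eq_sym (negbTE ik) (negbTE sk) /=.
  by rewrite eq_sym (negbTE ssk) pre_skip_suc // eqxx.
have U : uniq [:: k; k + 1; k + 2%:R; k + 3%:R] /\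
    uniq [:: k; k + 1; k + 3%:R; k + 2%:R].
  by move: k {ho hi hs hp}; apply: ord4P; split.
have [E1 E2 E3] :
  [/\ suc_skip k (k + 1) = k + 2%:R, suc_skip k (k + 2%:R) = k + 3%:R
    & suc_skip k (k + 3%:R) = k + 1].
  by move: k {ho hi hs hp U}; apply: ord4P; split; exact/eqP.
have [K1 K2 K3] : [/\ k + 1 != k, k + 2%:R != k & k + 3%:R != k].
  by move: k {ho hi hs hp U E1 E2 E3}; apply: ord4P; split.
have [D1 D2 D3] : [/\ k + 3%:R != k + 1, k + 1 != k + 2%:R & k + 2%:R != k + 3%:R].
  by move: k {ho hi hs hp U E1 E2 E3 K1 K2 K3}; apply: ord4P; split.
have s1 := hs _ K1; rewrite E1 in s1; have s2 := hs _ K2; rewrite E2 in s2.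
have s3 := hs _ K3; rewrite E3 in s3.
have p1 := hp _ K1; rewrite E1 E2 in p1; have p2 := hp _ K2; rewrite E2 E3 in p2.
have p3 := hp _ K3; rewrite E3 E1 in p3.
case=> pE; [exists (k + 1), (k + 3%:R), (k + 2%:R) | exists (k + 1), (k + 2%:R), (k + 3%:R)].
  split=> //; [by case: U | | by rewrite s1 ?s2 ?s3 // pE].
  by rewrite p1 ?p2 ?p3 // pE subr0.
split=> //; [by case: U | by rewrite s1 ?s2 ?s3 // pE | ].
by rewrite p1 ?p2 ?p3 // pE subrr.
Qed.

Lemma labels_cover (i0 i1 i2 i3 j : 'I_4) : uniq [:: i0; i1; i2; i3] ->
  j \in [:: i0; i1; i2; i3].
Proof.
move=> u; have S : {subset [:: i0; i1; i2; i3] <= enum 'I_4}.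
  by move=> x _; rewrite mem_enum.
have Z : (size (enum 'I_4) <= size [:: i0; i1; i2; i3])%N by rewrite size_enum_ord.
by have [_ ->] := uniq_min_size u S Z; rewrite mem_enum.
Qed.

Lemma sum_other (V : zmodType) (i a b c : 'I_4) (F : 'I_4 -> V) :
  uniq [:: i; a; b; c] -> \sum_(j | j != i) F j = F a + F b + F c.
Proof.
move=> u; have /= := u; rewrite !inE !negb_or.
move=> /andP[/and3P[ia ib ic] /andP[/andP[ab ac] /andP[bc _]]].
rewrite (bigD1 a) 1?eq_sym //= (bigD1 b) /=; last by rewrite ![b == _]eq_sym ib.
rewrite (bigD1 c) /=; last by rewrite ![c == _]eq_sym ic ac.
rewrite big1 ?addr0 ?addrA // => j /andP[/andP[/andP[ji ja] jb] jc].
have := labels_cover _ _ _ _ j u.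
by rewrite !inE (negbTE ji) (negbTE ja) (negbTE jb) (negbTE jc).
Qed.

End Labels.

(** * The flow of the cosines *)

Section Flow.
Context {R : realType} (k : 'I_4) (p : R) (f : R -> R).
Implicit Types (G : config R).
Local Notation X := (closed_loop k p f).
Local Notation g := (fun c : R => f (acos c)).

Lemma dot_suml (I : Type) (r : seq I) (P : pred I) (F : I -> 'cV[R]_3) y :
  dot (\sum_(i <- r | P i) F i) y = \sum_(i <- r | P i) dot (F i) y.
Proof.
apply: (big_morph (fun x => dot x y)) => [x z|]; first exact: dotDl.
by rewrite -[0](scale0r 0) dotZl mul0r.
Qed.

Lemma closed_loop_dot G (i a b c : 'I_4) y : S2_4 G -> uniq [:: i; a; b; c] ->
  let x j := agent G j in
  let r j := g (dot (x i) (x j)) * (dot (x i) (x j) * dot (x i) y - dot (x j) y) in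
  dot (X G i) y = weight k p i a * r a + weight k p i b * r b + weight k p i c * r c.
Proof.
move=> hG u x r.
have hu : dot (x i) (x i) = 1 by apply/enorm_unit.
rewrite -(sum_other _ _ _ _ _ (fun j => weight k p i j * r j) u).
rewrite /closed_loop mulmx_sumr dot_suml; apply: eq_bigr => j _.
by rewrite -scalemxAr hat_hat !dot_lin hu /r /theta; ring.
Qed.

Lemma spoke_flow G i0 i1 i2 i3 : S2_4 G -> hub_labels (weight k p) i0 i1 i2 i3 ->
  let x j := agent G j in
  dot (X G i0) (x i1) + dot (x i0) (X G i1) =
  spoke_rate g (dot (x i0) (x i1)) (dot (x i0) (x i2)) (dot (x i0) (x i3))
    (dot (x i1) (x i2)) (dot (x i2) (x i3)) (dot (x i3) (x i1)).
Proof.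
move=> hG [u ho hi [n1 n2 n3] [p1 p2 p3]] x.
have hu j : dot (x j) (x j) = 1 by apply/enorm_unit.
rewrite (closed_loop_dot _ _ _ _ _ _ hG u) (dotC (x i0) (X G i1)).
have u' : uniq [:: i1; i0; i2; i3].
  rewrite -(perm_uniq (s1 := [:: i0; i1; i2; i3])) //.
  by rewrite (perm_catCA [:: i0] [:: i1] [:: i2; i3]).
rewrite (closed_loop_dot _ _ _ _ _ _ hG u') !ho hi n1 p3 -!/(x _).
rewrite (dotC (x i1) (x i0)) (dotC (x i2) (x i0)) (dotC (x i2) (x i1)) !hu.
by rewrite /spoke_rate; field.
Qed.

Lemma rim_flow G i0 i1 i2 i3 : S2_4 G -> hub_labels (weight k p) i0 i1 i2 i3 ->
  let x j := agent G j in
  dot (X G i1) (x i2) + dot (x i1) (X G i2) =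
  rim_rate g (dot (x i0) (x i1)) (dot (x i0) (x i2)) (dot (x i0) (x i3))
    (dot (x i1) (x i2)) (dot (x i2) (x i3)) (dot (x i3) (x i1)).
Proof.
move=> hG L x; have L' := hub_rot _ _ _ _ _ L.
have [u _ hi [n1 n2 _] [p1 _ p3]] := L; have [u2 _ _ _ _] := L'.
have hu j : dot (x j) (x j) = 1 by apply/enorm_unit.
have u1 : uniq [:: i1; i0; i2; i3].
  rewrite -(perm_uniq (s1 := [:: i0; i1; i2; i3])) //.
  by rewrite (perm_catCA [:: i0] [:: i1] [:: i2; i3]).
have {}u2 : uniq [:: i2; i0; i3; i1].
  rewrite -(perm_uniq (s1 := [:: i0; i2; i3; i1])) //.
  by rewrite (perm_catCA [:: i0] [:: i2] [:: i3; i1]).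
rewrite (closed_loop_dot _ _ _ _ _ _ hG u1) (dotC (x i1) (X G i2)).
rewrite (closed_loop_dot _ _ _ _ _ _ hG u2) !hi n1 n2 p1 p3 -!/(x _).
rewrite (dotC (x i1) (x i0)) (dotC (x i2) (x i0)) (dotC (x i2) (x i1)) !hu.
by rewrite /rim_rate; field.
Qed.

Lemma is_derive_dot (x y : R -> 'cV[R]_3) (t : R) dx dy :
  is_derive t (1 : R) x dx -> is_derive t (1 : R) y dy ->
  is_derive t (1 : R) (fun s => dot (x s) (y s)) (dot dx (y t) + dot (x t) dy).
Proof.
move=> Hx Hy.
have comp (z : R -> 'cV[R]_3) dz a : is_derive t (1 : R) z dz ->
    is_derive t (1 : R) (fun s => z s a 0) (dz a 0).
  move=> [Dz <-]; apply: DeriveDef; first by move/derivable_mxP: Dz; apply.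
  by rewrite derive_mx // mxE.
have Dx a := comp _ _ a Hx; have Dy a := comp _ _ a Hy.
have E (u v : R -> 'cV[R]_3) : (fun s => dot (u s) (v s)) =
    \sum_(a < 3) ((fun s => u s a 0) * (fun s => v s a 0)).
  by apply/funext => s; rewrite fct_sumE.
rewrite E; apply: is_derive_eq.
rewrite /dot -big_split /=; apply: eq_bigr => a _.
by rewrite /GRing.scale /= addrC; congr (_ + _); exact: mulrC.
Qed.

Lemma is_derive_lyap (u1 u2 u3 w1 w2 w3 : R -> R) (t : R) (du1 du2 du3 dw1 dw2 dw3 : R) :
  is_derive t (1 : R) u1 du1 -> is_derive t (1 : R) u2 du2 -> is_derive t (1 : R) u3 du3 ->
  is_derive t (1 : R) w1 dw1 -> is_derive t (1 : R) w2 dw2 -> is_derive t (1 : R) w3 dw3 ->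
  is_derive t (1 : R) (fun s => lyap (u1 s) (u2 s) (u3 s) (w1 s) (w2 s) (w3 s))
   ((2 * u1 t - w1 t) * du1 + (2 * u2 t - w2 t) * du2 + (2 * u3 t - w3 t) * du3
    + (2 * w1 t - u1 t) * dw1 + (2 * w2 t - u2 t) * dw2 + (2 * w3 t - u3 t) * dw3).
Proof.
move=> D1 D2 D3 D4 D5 D6.
have Q (u w : R -> R) du dw : is_derive t (1 : R) u du -> is_derive t (1 : R) w dw ->
    is_derive t (1 : R) (u * u + w * w - u * w)
      ((u t *: du + u t *: du) + (w t *: dw + w t *: dw) - (u t *: dw + w t *: du)).
  move=> Hu Hw.
  exact: (is_deriveB (is_deriveD (is_deriveM Hu Hu) (is_deriveM Hw Hw)) (is_deriveM Hu Hw)).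
have H := is_deriveD (is_deriveD (Q _ _ _ _ D1 D4) (Q _ _ _ _ D2 D5)) (Q _ _ _ _ D3 D6).
congr (is_derive t (1 : R) _ _): H.
by rewrite /GRing.scale /=; ring.
Qed.

Definition config_lyap i0 i1 i2 i3 G : R :=
  lyap (gap G i0 i1) (gap G i0 i2) (gap G i0 i3)
       (gap G i1 i2) (gap G i2 i3) (gap G i3 i1).

Definition config_lyap_rate i0 i1 i2 i3 G : R :=
  lyap_rate g (gap G i0 i1) (gap G i0 i2) (gap G i0 i3)
              (gap G i1 i2) (gap G i2 i3) (gap G i3 i1).

(** The rates of all six cosines come from [spoke_flow] and [rim_flow] for the
three rotations of the rim labels. *)
Lemma config_lyap_flow i0 i1 i2 i3 (I : interval R) (G : R -> config R) t :
  hub_labels (weight k p) i0 i1 i2 i3 -> is_solution X I G -> [set` I]° t ->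
  S2_4 (G t) ->
  is_derive t (1 : R) (config_lyap i0 i1 i2 i3 \o G)
    (config_lyap_rate i0 i1 i2 i3 (G t)).
Proof.
move=> L [_ _ hd] tI hG; have L2 := hub_rot _ _ _ _ _ L; have L3 := hub_rot _ _ _ _ _ L2.
have D i j : is_derive t (1 : R) (fun s => gap (G s) i j)
    (dot (X (G t) i) (agent (G t) j) + dot (agent (G t) i) (X (G t) j)).
  have Hd := is_derive_dot _ _ t _ _ (hd t i tI) (hd t j tI).
  by rewrite -[X in is_derive _ _ _ X]addr0; exact: is_deriveD.
have := is_derive_lyap _ _ _ _ _ _ t _ _ _ _ _ _ (D i0 i1) (D i0 i2) (D i0 i3)
  (D i1 i2) (D i2 i3) (D i3 i1).
rewrite (spoke_flow _ _ _ _ _ hG L) (spoke_flow _ _ _ _ _ hG L2) (spoke_flow _ _ _ _ _ hG L3).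
rewrite (rim_flow _ _ _ _ _ hG L) (rim_flow _ _ _ _ _ hG L2) (rim_flow _ _ _ _ _ hG L3).
have gE i j : dot (agent (G t) i) (agent (G t) j) = gap (G t) i j - 3^-1.
  by rewrite /gap addrK.
by rewrite !gE.
Qed.

Lemma config_lyap_continuous i0 i1 i2 i3 : continuous (config_lyap i0 i1 i2 i3).
Proof.
have gapE i j : (fun G : config R => gap G i j) = dot_constraint i j (- 3^-1).
  by apply/funext => G; rewrite dot_constraintE opprK.
have P i j : entry_poly (fun G : config R => gap G i j).
  by rewrite gapE; exact: entry_poly_pair.
have Q (u w : config R -> R) : entry_poly u -> entry_poly w ->
    entry_poly (u * u + w * w + cst (-1) * (u * w)).
  by move=> pu pw; do ![exact: EPcst | exact: pu | exact: pw | apply: EPadd | apply: EPmul].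
have E : entry_poly (config_lyap i0 i1 i2 i3).
  have := EPadd _ _ (EPadd _ _ (Q _ _ (P i0 i1) (P i1 i2)) (Q _ _ (P i0 i2) (P i2 i3)))
                (Q _ _ (P i0 i3) (P i3 i1)).
  congr entry_poly; apply/funext => G; rewrite /config_lyap /lyap !fctE; ring.
by move=> G; apply/differentiable_continuous/entry_poly_differentiable.
Qed.
End Flow.

(** * Invariance and exponential stability *)

Lemma itv_interior {R : realType} (I : interval R) (a b t : R) :
  a \in I -> b \in I -> a < t < b -> [set` I]° t.
Proof.
move=> aI bI ab.
have : nbhs t [set` `]a, b[ ].
  by apply: open_nbhs_nbhs; split; [exact: interval_open | rewrite /= in_itv].
apply: filterS => s; rewrite /= in_itv /= => /andP[sa sb].
by apply: (interval_is_interval aI bI); rewrite !ltW.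
Qed.

Arguments config_lyap_flow {R k p f i0 i1 i2 i3 I G t}.

Section Stability.
Context {R : realType} (k : 'I_4) (p : R) (f : R -> R).
Implicit Types (G : config R).
Local Notation X := (closed_loop k p f).
Local Notation g := (fun c : R => f (acos c)).

Lemma gapC G i j : gap G i j = gap G j i.
Proof. by rewrite /gap dotC. Qed.

Lemma gap_le_sqrt G i0 i1 i2 i3 (N : R) : uniq [:: i0; i1; i2; i3] ->
  sumsq (gap G i0 i1) (gap G i0 i2) (gap G i0 i3)
        (gap G i1 i2) (gap G i2 i3) (gap G i3 i1) <= N ->
  forall i j, i != j -> `|gap G i j| <= Num.sqrt N.
Proof.
move=> u /sumsq_entries [[h1 h2 h3] [k1 k2 k3]] i j.
move: (labels_cover _ _ _ _ i u) (labels_cover _ _ _ _ j u); rewrite !inE.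
by case/or4P => /eqP-> /or4P[] /eqP->; rewrite ?eqxx // => _; rewrite // gapC.
Qed.

Lemma config_lyap_le G i0 i1 i2 i3 (m : R) : uniq [:: i0; i1; i2; i3] ->
  (forall i j, i != j -> `|gap G i j| <= m) ->
  config_lyap i0 i1 i2 i3 G <= 9 * (m * m).
Proof.
move=> /uniq4P[[n1 n2 n3] [n4 n5 n6]] h.
have [_ V] := lyap_bounds (gap G i0 i1) (gap G i0 i2) (gap G i0 i3)
  (gap G i1 i2) (gap G i2 i3) (gap G i3 i1).
have q i j : i != j -> gap G i j ^+ 2 <= m * m.
  move=> ij; rewrite -real_normK ?num_real // expr2.
  by apply: ler_pM => //; exact: h.
move: V (q _ _ n1) (q _ _ n2) (q _ _ n3) (q _ _ n4) (q _ _ n5) (q _ _ n6).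
rewrite /config_lyap /sumsq; lra.
Qed.

Definition lyap_decreasing (i0 i1 i2 i3 : 'I_4) (rho lambda L : R) : Prop :=
  forall G, S2_4 G -> config_lyap i0 i1 i2 i3 G < rho ->
  config_lyap_rate f i0 i1 i2 i3 G <= - lambda * config_lyap i0 i1 i2 i3 G /\
  `|config_lyap_rate f i0 i1 i2 i3 G| <= L * config_lyap i0 i1 i2 i3 G.

(** The threshold rho also guarantees that the gaps are at most 1 / 100, which is
the range of [near_tetrahedra]. *)
Lemma ex_lyap_decreasing (i0 i1 i2 i3 : 'I_4) :
  (forall x : R, 0 < x < pi -> 0 < f x) ->
  (forall x : R, 0 < x < pi -> derivable f x 1 /\ derive1 f x < 0) ->
  uniq [:: i0; i1; i2; i3] ->
  exists rho lambda L, [/\ 0 < rho <= 100^-1 * 100^-1 / 2, 0 < lambda, 0 < L &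
    lyap_decreasing i0 i1 i2 i3 rho lambda L].
Proof.
move=> hpos hdec u.
have [beta [gamma [b0 c0 hg]]] := profile_expansion f hpos hdec.
have C0 : 0 <= 3 / 2 * 9600 ^+ 2 :> R by have := sqr_ge0 (9600 : R); lra.
have [r [lambda [L [r0 l0 L0 H]]]] := lyap_decay g beta gamma _ b0 c0 C0 hg.
clear C0; exists (Num.min (r / 2) (100^-1 * 100^-1 / 2)), lambda, L; split => //.
  by rewrite lt_min ge_min lexx orbT andbT; apply/andP; split; lra.
move=> G hG; rewrite lt_min => /andP[V1 V2].
have [V3 _] := lyap_bounds (gap G i0 i1) (gap G i0 i2) (gap G i0 i3)
  (gap G i1 i2) (gap G i2 i3) (gap G i3 i1).
rewrite -/(config_lyap i0 i1 i2 i3 G) in V3.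
apply: H; first lra.
set N := sumsq _ _ _ _ _ _ in V3 *.
have N0 : 0 <= N by rewrite /N /sumsq !addr_ge0 ?sqr_ge0.
have hm : 0 <= Num.sqrt N <= 100^-1.
  rewrite sqrtr_ge0 /= -[leRHS]ger0_norm // -sqrtr_sqr ler_wsqrtr //.
  by rewrite expr2; lra.
have := gap_sum_le G _ _ _ _ _ u hG hm (gap_le_sqrt _ _ _ _ _ _ u (lexx N)).
by rewrite -expr2 sqr_sqrtr // mulrA.
Qed.

(** The form is positive definite in the gaps. *)
Lemma config_lyap_tetrahedra G i0 i1 i2 i3 : uniq [:: i0; i1; i2; i3] -> S2_4 G ->
  config_lyap i0 i1 i2 i3 G <= 0 <-> tetrahedra G.
Proof.
move=> u hG; split=> [V|[_ hT]].
  split=> // i j ij.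
  have [V3 _] := lyap_bounds (gap G i0 i1) (gap G i0 i2) (gap G i0 i3)
    (gap G i1 i2) (gap G i2 i3) (gap G i3 i1).
  have N0 : sumsq (gap G i0 i1) (gap G i0 i2) (gap G i0 i3)
    (gap G i1 i2) (gap G i2 i3) (gap G i3 i1) <= 0 by move: V V3; rewrite /config_lyap; lra.
  have := gap_le_sqrt _ _ _ _ _ _ u N0 i j ij.
  by rewrite sqrtr0 normr_le0 addr_eq0 => /eqP.
apply: le_trans (config_lyap_le G _ _ _ _ 0 u _) _; last by rewrite mul0r mulr0.
by move=> i j ij; rewrite /gap hT // addNr normr0.
Qed.

Lemma config_lyap_ge0 G i0 i1 i2 i3 : 0 <= config_lyap i0 i1 i2 i3 G.
Proof.
have [V _] := lyap_bounds (gap G i0 i1) (gap G i0 i2) (gap G i0 i3)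
    (gap G i1 i2) (gap G i2 i3) (gap G i3 i1).
have : 0 <= 2 * config_lyap i0 i1 i2 i3 G.
  by apply: le_trans V; rewrite /sumsq !addr_ge0 ?sqr_ge0.
by rewrite pmulr_rge0.
Qed.

Lemma config_lyap_within i0 i1 i2 i3 (I : interval R) (G : R -> config R) a b :
  {within [set` I], continuous G} -> a \in I -> b \in I ->
  {within `[a, b], continuous (config_lyap i0 i1 i2 i3 \o G)}.
Proof.
move=> hG aI bI; apply: (@continuous_subspaceW _ _ _ [set` I]).
  move=> s; rewrite /= in_itv /= => sab.
  exact: (interval_is_interval aI bI).
apply/subspace_continuousP => x xI.
have Gx : G y @[y --> within [set` I] (nbhs x)] --> G x.
  by move/subspace_continuousP : hG; apply.
exact: (cvg_comp _ _ Gx (@config_lyap_continuous R i0 i1 i2 i3 (G x))).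
Qed.

(** V starts at 0, where the two-sided bound |V'| <= L V forces it to stay, both
forward and backward in time. *)
Lemma tetrahedra_invariant i0 i1 i2 i3 rho lambda L :
  hub_labels (weight k p) i0 i1 i2 i3 -> 0 < rho ->
  lyap_decreasing i0 i1 i2 i3 rho lambda L -> invariant_set X tetrahedra.
Proof.
move=> lab rho0 hdec I G hs I0 hT t tI.
have [hc hS _] := hs; have u := hub_uniq _ _ _ _ _ lab.
pose V := config_lyap i0 i1 i2 i3 \o G.
have V0 : V 0 = 0.
  by apply/eqP; rewrite eq_le config_lyap_ge0 andbT; apply/config_lyap_tetrahedra => //; exact: hS.
have hD s a b : a \in I -> b \in I -> a < s < b -> exists2 d : R,
    is_derive s (1 : R) V d & V s < rho -> `|d| <= L * V s.
  move=> aI bI ab; have sI := itv_interior _ _ _ _ aI bI ab.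
  have Ss := hS _ (interior_subset sI).
  exists (config_lyap_rate f i0 i1 i2 i3 (G s)).
    exact: config_lyap_flow lab hs sI Ss.
  by move=> /(hdec _ Ss)[].
apply/(config_lyap_tetrahedra _ _ _ _ _ u (hS _ tI)).
have [t0|t0] := leP 0 t.
  have := @gronwall R V L rho t (config_lyap_within _ _ _ _ _ _ _ _ hc I0 tI) _ _ t.
  rewrite V0 mul0r lexx t0; apply=> //; last by move=> *; rewrite mul0r.
  move=> s st; have [d Hd dle] := hD _ _ _ I0 tI st; exists d => // Vs.
  exact: le_trans (ler_norm _) (dle Vs).
have := @gronwall_backward R V L rho t (config_lyap_within _ _ _ _ _ _ _ _ hc tI I0) _ _ t.
rewrite V0 mul0r lexx (ltW t0); apply=> //; last by move=> *; rewrite mul0r.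
move=> s st; have [d Hd dle] := hD _ _ _ tI I0 st; exists d => // Vs.
by apply: le_trans (dle Vs); rewrite -normrN ler_norm.
Qed.

(** V decays at rate lambda and is comparable to the square of the distance,
hence the rate lambda / 2 for the distance. *)
Lemma tetrahedra_exponentially_stable i0 i1 i2 i3 rho lambda L :
  hub_labels (weight k p) i0 i1 i2 i3 -> 0 < rho <= 100^-1 * 100^-1 / 2 -> 0 < lambda ->
  lyap_decreasing i0 i1 i2 i3 rho lambda L -> exponentially_stable X tetrahedra.
Proof.
move=> lab /andP[rho0 rho1] l0 hdec; have u := hub_uniq _ _ _ _ _ lab.
(* V <= 9 m ^ 2 with m = 6 D gives V(0) <= 324 D ^ 2, and the gaps are at most
   sqrt (2 V); the other factors come from the distance estimate. *)
pose c : R := Num.sqrt 12 * 2400 * Num.sqrt 648.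
have c0 : 0 < c by rewrite !mulr_gt0 ?sqrtr_gt0 ?ltr0n.
exists (Num.sqrt (rho / 324)), c, (lambda / 2); split.
- by rewrite sqrtr_gt0 divr_gt0 ?ltr0n.
- exact: c0.
- by rewrite divr_gt0.
move=> I G hs I0; set D := edist_set (G 0) tetrahedra => hD t tI t0.
have [hc hS _] := hs; pose V := config_lyap i0 i1 i2 i3 \o G.
have D0 : 0 <= D.
  apply: lb_le_inf; last by move=> _ [B _ <-]; exact: sqrtr_ge0.
  by have [B hB] := @tetrahedra_nonempty R; exists (enorm (G 0 - B)), B.
have V0 : V 0 <= 324 * (D * D).
  apply: le_trans (config_lyap_le _ _ _ _ _ (6 * D) u _) _.
    by move=> i j; apply: gap_le_edist_set; exact: hS.
  lra.
have V0rho : V 0 < rho.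
  have : D * D < Num.sqrt (rho / 324) * Num.sqrt (rho / 324).
    by rewrite -!expr2 ltr_sqr ?nnegrE ?sqrtr_ge0.
  rewrite -(expr2 (Num.sqrt _)) sqr_sqrtr; last by rewrite divr_ge0 ?ler0n // ltW.
  by move: V0; lra.
have V0' : 0 <= V 0 by exact: config_lyap_ge0.
have dec s : 0 <= s -> V 0 * expR (- lambda * s) <= V 0.
  move=> s0; rewrite ler_piMr // -expR0 ler_expR mulNr oppr_le0.
  by rewrite mulr_ge0 // ltW.
have Vt : V t <= V 0 * expR (- lambda * t).
  apply: (@gronwall R V (- lambda) rho t (config_lyap_within _ _ _ _ _ _ _ _ hc I0 tI)).
  - move=> s st; have sI := itv_interior _ _ _ _ I0 tI st.
    have Ss := hS _ (interior_subset sI).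
    exists (config_lyap_rate f i0 i1 i2 i3 (G s)).
      exact: config_lyap_flow lab hs sI Ss.
    by move=> /(hdec _ Ss)[].
  - by move=> s /andP[s0 _]; apply: le_lt_trans (dec _ s0) _.
  - by rewrite t0 lexx.
have Vtr : V t < rho by apply: le_lt_trans Vt _; apply: le_lt_trans (dec _ t0) _.
have [N1 _] := lyap_bounds (gap (G t) i0 i1) (gap (G t) i0 i2) (gap (G t) i0 i3)
  (gap (G t) i1 i2) (gap (G t) i2 i3) (gap (G t) i3 i1).
rewrite -/(config_lyap i0 i1 i2 i3 (G t)) -/(V t) in N1.
have hm : 0 <= Num.sqrt (2 * V t) <= 100^-1.
  rewrite sqrtr_ge0 /= -[leRHS]ger0_norm // -sqrtr_sqr ler_wsqrtr //.
  by rewrite expr2; lra.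
apply: le_trans (edist_set_le _ _ (hS _ tI) hm (gap_le_sqrt _ _ _ _ _ _ u N1)) _.
have E : Num.sqrt (2 * V t) <= Num.sqrt 648 * (expR (- (lambda / 2 * t)) * D).
  rewrite -[expR _ * D]ger0_norm; last by rewrite mulr_ge0 // expR_ge0.
  rewrite -sqrtr_sqr -sqrtrM ?ler0n // ler_wsqrtr // exprMn.
  have -> : expR (- (lambda / 2 * t)) ^+ 2 = expR (- lambda * t).
    by rewrite expr2 -expRD; congr expR; field.
  have := ler_wpM2r (expR_ge0 (- lambda * t)) V0; rewrite expr2; lra.
have q0 : 0 <= Num.sqrt 12 * 2400 :> R by rewrite mulr_ge0 ?sqrtr_ge0 ?ler0n.
have := ler_wpM2l q0 E; rewrite /c !mulrA; exact.
Qed.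
End Stability.

Theorem theorem5p2 (R : realType) (k : 'I_4) (p : R) (f : R -> R)
  (hp : p = 0 \/ p = 1)
  (hbounded : exists M : R, forall x : R, `|f x| <= M)
  (hpos : forall x : R, 0 < x < pi -> 0 < f x)
  (hdec : forall x : R, 0 < x < pi -> derivable f x 1 /\ derive1 f x < 0) :
  invariant_manifold (closed_loop k p f) tetrahedra /\
  exponentially_stable (closed_loop k p f) tetrahedra.
Proof.
have [i1 [i2 [i3 lab]]] := weight_hub k p hp.
have [rho [lambda [L [hrho l0 _ hd]]]] :=
  ex_lyap_decreasing f k i1 i2 i3 hpos hdec (hub_uniq _ _ _ _ _ lab).
split; last exact: tetrahedra_exponentially_stable lab hrho l0 hd.
split; first by move=> G [].
  by exists 9%N; exact: tetrahedra_submanifold.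
by case/andP: hrho => r0 _; exact: tetrahedra_invariant lab r0 hd.
Qed.
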